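(* Every strongly increasing parametrised model has a sharp transition. That is, let $p_1<p_2$ be real numbers and let $(\upsilon_p)_{p\in[p_1,p_2]}$ be a continuously differentiable curve of attractive PCA for which there exists $c_0>0$ such that for every down-set $\mathscr D$ of $(\mathscr U,\supset)$ with $\mathscr D\notin\{\varnothing,\mathscr U\}$ and every $p\in[p_1,p_2]$, $$\upsilon_p'(\mathscr D)\le -c_0\left(1-\upsilon_p(\mathscr D)\right).$$ Let $p_{\mathrm c}=\inf\{p\in[p_1,p_2]:\delta_{\mathbf 0}\text{ is not the unique invariant measure of }\upsilon_p\}$, with $\inf\varnothing=p_2$. Then for every $p\in[p_1,p_{\mathrm c})$ there exist $c,C>0$ such that for all integers $t>0$ and all finite $A\subset\mathbb Z^d\times([-r,0)\cap\mathbb Z)$, $$\mathbb P_{\upsilon_p}\left(\eta_0^{\mathbf 1}(t)\neq0\right)\le Ce^{-ct},\qquad \mathbb P_{\upsilon_p}\left(\eta^A(t)\neq\mathbf 0\right)\le C|A|e^{-ct}.$$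
   Context: Fix an integer $d\ge 1$ and a range $r\in[1,\infty)$. Set $R=([-r,r]^d\times[-r,0))\cap\mathbb Z^{d+1}$. For any set $X$, elements of $\{0,1\}^X$ are identified with subsets of $X$ (the set of points with value $1$). A configuration is an element of $\Omega=\{0,1\}^{\mathbb Z^d\times([-r,0)\cap\mathbb Z)}$. Let $\Omega_R=\{0,1\}^R$, identified with the power set of $R$ and ordered by inclusion. An up-family is a collection $\mathcal U\subset\Omega_R$ such that $X\in\mathcal U$ and $X\subset Y\subset R$ imply $Y\in\mathcal U$. Let $\mathscr U$ be the (finite) system of all up-families. A down-set of $(\mathscr U,\supset)$ is a subset $\mathscr D\subset\mathscr U$ such that $\mathcal U\in\mathscr D$, $\mathcal V\in\mathscr U$ and $\mathcal V\subset\mathcal U$ imply $\mathcal V\in\mathscr D$. An attractive PCA (probabilistic cellular automaton) is a probability measure $\upsilon$ on $\mathscr U$; the set of these is a finite-dimensional simplex with its standard topology. A parametrised model is a continuously differentiable curve $(\upsilon_p)_{p\in[p_1,p_2]}$ in this space; the derivative $\upsilon'_p=\lim_{q\to p}(\upsilon_q-\upsilon_p)/(q-p)$ is a signed measure on $\mathscr U$. Given $\upsilon$, let $(\mathcal U_{x,t})_{(x,t)\in\mathbb Z^d\times\mathbb Z}$ be i.i.d. up-families with law $\upsilon$, whose joint law is denoted $\mathbb P_\upsilon$. Given $\omega\in\Omega$, the process $\eta^\omega$ started from $\omega$ has $\eta^\omega_x(s)=\omega_{(x,s)}$ for $s\in[-r,0)\cap\mathbb Z$, and, inductively for integers $t\ge0$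 and $x\in\mathbb Z^d$, $\eta^\omega_x(t)=1$ if $\{(y,s)\in R:\eta^\omega_{x+y}(t+s)=1\}\in\mathcal U_{x,t}$ and $\eta^\omega_x(t)=0$ otherwise. We write $\eta^\omega(t)=(\eta^\omega_x(t))_{x\in\mathbb Z^d}$. The symbols $\mathbf 0$ and $\mathbf 1$ denote the all-$0$ and all-$1$ configurations (on the relevant index set). An invariant measure is a probability measure on $\Omega$ such that, if the initial configuration has this law and is independent of the field, then for all $t\ge0$ the configuration $(\eta_x(t+s))_{x\in\mathbb Z^d,\,s\in[-r,0)\cap\mathbb Z}$ has the same law. *)

(* Defs.v *)
From HB Require Import structures.
From mathcomp Require Import all_boot all_order all_algebra.
From mathcomp Require Import finmap.
From mathcomp Require Import all_classical all_reals all_analysis.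

Set Implicit Arguments.
Unset Strict Implicit.
Unset Printing Implicit Defensive.
Import Order.TTheory GRing.Theory Num.Theory.
Import numFieldNormedType.Exports.
Local Open Scope classical_set_scope.
Local Open Scope ring_scope.

Notation site d := 'rV[int]_d.

Definition past_set (R : realType) (r : R) : set int :=
  [set s | - r <= (s%:~R : R) < 0].

Definition nbh_set (R : realType) (d : nat) (r : R) : set (site d * int) :=
  [set z : site d * int | (forall i, - r <= ((z.1 0 i)%:~R : R) <= r) /\ - r <= (z.2%:~R : R) < 0].

(* [fset_set] is junk ([fset0]) on infinite sets; [mem_past] and [mem_nbh]
   below show that it is used properly here. *)
Definition past (R : realType) (r : R) : {fset int} := fset_set (past_set r).

Definition nbh (R : realType) (d : nat) (r : R) : {fset site d * int} :=
  fset_set (@nbh_set R d r).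

Lemma finite_bounded_int (R : realType) (r : R) :
  finite_set [set s : int | - r <= (s%:~R : R) <= r].
Proof.
set N := Num.bound `|r|.
apply: (@sub_finite_set _ _
  ((fun k : 'I_N.*2.+1 => (k : nat)%:Z - N%:Z) @` [set: 'I_N.*2.+1])); last first.
  by apply: finite_image; exact: finite_finset.
move=> s /= /andP[s1 s2].
have rN : r < N%:R.
  by apply: le_lt_trans (ler_norm r) _; exact: archi_boundP.
have h1 : - N%:Z <= s.
  rewrite -(ler_int R) mulrNz; apply: le_trans s1.
  by rewrite lerN2 ltW.
have h2 : s <= N%:Z by rewrite -(ler_int R); apply: le_trans s2 (ltW _).
have h3 : 0 <= s + N%:Z by rewrite -lerBlDr sub0r.
have h4 : (absz (s + N%:Z)%R < N.*2.+1)%N.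
  rewrite ltnS -lez_nat gez0_abs// -addnn PoszD lerD2r//.
exists (Ordinal h4) => //=.
by rewrite gez0_abs// addrK.
Qed.

Lemma finite_past (R : realType) (r : R) : finite_set (past_set r).
Proof.
apply: sub_finite_set (finite_bounded_int r) => s /= /andP[s1 s0].
rewrite s1/=; have r0 : 0 <= r.
  by rewrite -oppr_le0; apply: le_trans s1 (ltW s0).
exact: le_trans (ltW s0) r0.
Qed.

Lemma finite_nbh (R : realType) (d : nat) (r : R) : finite_set (@nbh_set R d r).
Proof.
pose B := fset_set [set s : int | - r <= (s%:~R : R) <= r].
pose f (g : {ffun 'I_d -> B}) : site d := \row_i (val (g i) : int).
apply: (@sub_finite_set _ _ ((f @` setT) `*` past_set r)); last first.
  apply: finite_setX; last exact: finite_past.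
  by apply: finite_image; exact: finite_finset.
move=> [y s] [/= hy hs]; split => //=.
have hB i : y 0 i \in B.
  rewrite in_fset_set; last exact: finite_bounded_int.
  by rewrite inE /=; exact: hy.
exists [ffun i => [` hB i]%fset] => //.
by apply/rowP => i; rewrite !mxE ffunE.
Qed.

Lemma mem_past (R : realType) (r : R) s :
  (s \in past r) = (- r <= (s%:~R : R) < 0).
Proof.
rewrite in_fset_set; last exact: finite_past.
by apply/idP/idP; rewrite inE.
Qed.

Lemma mem_nbh (R : realType) (d : nat) (r : R) (z : site d * int) :
  (z \in nbh d r) =
  [forall i, - r <= ((z.1 0 i)%:~R : R) <= r] && (- r <= (z.2%:~R : R) < 0).
Proof.
rewrite in_fset_set; last exact: finite_nbh.
apply/idP/idP; rewrite inE.
  by move=> [/= h ->]; rewrite andbT; apply/forallP.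
by move=> /andP[/forallP h1 h2].
Qed.

Definition config (R : realType) (d : nat) (r : R) : Type :=
  site d * past r -> bool.

Definition config0 (R : realType) (d : nat) (r : R) : config d r :=
  fun=> false.

Definition config1 (R : realType) (d : nat) (r : R) : config d r :=
  fun=> true.

Arguments config0 {R} d r.
Arguments config1 {R} d r.

Definition config_of_set (R : realType) (d : nat) (r : R)
  (A : {fset site d * past r}) : config d r := fun z => z \in A.

Definition cylinders (R : realType) (d : nat) (r : R) :
    set (set (config d r)) :=
  [set E | exists z, E = [set omega : config d r | omega z]].

(* Omega with its product sigma-algebra *)
Notation Omega d r := (g_sigma_algebraType (@cylinders _ d r)).

Definition up_closed (R : realType) (d : nat) (r : R)
    (U : {set {set nbh d r}}) : bool :=
  [forall X : {set nbh d r}, forall Y : {set nbh d r},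
    (X \in U) && (X \subset Y) ==> (Y \in U)].

Definition upfam (R : realType) (d : nat) (r : R) : finType :=
  {U : {set {set nbh d r}} | up_closed U}.

Definition down_set (R : realType) (d : nat) (r : R)
    (D : {set upfam d r}) : Prop :=
  forall U V : upfam d r, U \in D -> val V \subset val U -> V \in D.

(* An attractive PCA: a probability measure on the finite set of up-families,
   given by its mass function. *)
Record pca (R : realType) (d : nat) (r : R) := PCA {
  mass :> upfam d r -> R ;
  mass_ge0 : forall U, 0 <= mass U ;
  mass_sum1 : \sum_U mass U = 1 }.

(* value on a set of up-families of the signed measure with mass function m *)
Definition meas (R : realType) (d : nat) (r : R) (m : upfam d r -> R)
    (D : {set upfam d r}) : R := \sum_(U in D) m U.

Section process.
Context (R : realType) (d : nat) (r : R).
Implicit Types (omega : config d r) (F : site d * int -> upfam d r).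

(* [pca_eta_upto omega F n x s] is the process at site x and time s, correct for
   all times - r <= s < n. *)
Fixpoint pca_eta_upto omega F (n : nat) (x : site d) (s : int) : bool :=
  match n with
  | 0%N => if insub s is Some u then omega (x, u) else false
  | m.+1 =>
      if s == m%:Z then
        [set z : nbh d r |
          pca_eta_upto omega F m (x + (val z).1) (m%:Z + (val z).2)]%SET
          \in val (F (x, m%:Z))
      else pca_eta_upto omega F m x s
  end.

Definition pca_eta omega F (x : site d) (s : int) : bool :=
  pca_eta_upto omega F `|s|.+1 x s.

Lemma pca_eta_upto_past omega F n x (s : past r) :
  pca_eta_upto omega F n x (val s) = omega (x, s).
Proof.
elim: n => [|n IHn] /=; first by rewrite valK.
case: eqP => // sn; have := fsvalP s; rewrite sn mem_past => /andP[_].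
by rewrite ltrz0.
Qed.

Lemma pca_eta_uptoE omega F n x (s : int) : s < n%:Z ->
  pca_eta_upto omega F n x s = pca_eta omega F x s.
Proof.
case: s => [k|k]; last first.
  move=> _; rewrite /pca_eta; elim: n => [|n IHn].
    by elim: (`|Negz k|.+1) => [//|m IHm] /=; rewrite -IHm.
  by rewrite /= IHn.
rewrite ltz_nat /pca_eta absz_nat; elim: n => // n IHn.
rewrite ltnS leq_eqVlt => /orP[/eqP-> //|kn].
have -> : pca_eta_upto omega F n.+1 x k = pca_eta_upto omega F n x k.
  by rewrite /=; case: eqP => // -[kn']; rewrite kn' ltnn in kn.
exact: IHn.
Qed.

Lemma pca_eta_past omega F x (s : past r) : pca_eta omega F x (val s) = omega (x, s).
Proof. exact: pca_eta_upto_past. Qed.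

Lemma pca_eta_next omega F x (t : nat) :
  pca_eta omega F x t%:Z =
  ([set z : nbh d r | pca_eta omega F (x + (val z).1) (t%:Z + (val z).2)]%SET
     \in val (F (x, t%:Z))).
Proof.
rewrite {1}/pca_eta absz_nat /= eqxx.
set X := (X in X \in _); set Y := (Y in _ = (Y \in _)).
suff -> : X = Y by [].
apply/finset.setP => z; rewrite !finset.inE pca_eta_uptoE//.
have := fsvalP z; rewrite mem_nbh => /andP[_ /andP[_]].
by rewrite ltrz0 => ?; rewrite gtrDl.
Qed.

Definition window omega F (t : nat) : config d r :=
  fun z => pca_eta omega F z.1 (t%:Z + val z.2).

End process.

Definition field_events (R : realType) (d : nat) (r : R) (T : Type)
    (F : T -> site d * int -> upfam d r) : set (set T) :=
  [set E | exists z (B : {set upfam d r}), E = [set w | F w z \in B]].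

Definition iid_field (R : realType) (d : nat) (r : R) (ups : pca d r)
    (dT : measure_display) (T : measurableType dT) (P : probability T R)
    (F : T -> site d * int -> upfam d r) : Prop :=
  [/\ field_events F `<=` measurable,
      forall z (B : {set upfam d r}),
        P [set w | F w z \in B] = (meas ups B)%:E
    & forall (J : {fset site d * int}) (B : site d * int -> {set upfam d r}),
        P (\bigcap_(z in [set` J]) [set w | F w z \in B z]) =
        (\prod_(z <- J) P [set w | F w z \in B z])%E].

Definition indep_of_field (R : realType) (d : nat) (r : R)
    (dT : measure_display) (T : measurableType dT) (P : probability T R)
    (omega : T -> Omega d r) (F : T -> site d * int -> upfam d r) : Prop :=
  forall (E : set (Omega d r)) (G : set T),
    measurable E -> <<s field_events F >> G ->
    P ((omega @^-1` E) `&` G) = (P (omega @^-1` E) * P G)%E.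

(* The law of the process does not depend on the probability space carrying the
   initial condition and the field, so one quantifies over all of them. *)
Definition invariant_measure (R : realType) (d : nat) (r : R) (ups : pca d r)
    (mu : probability (Omega d r) R) : Prop :=
  forall (dT : measure_display) (T : measurableType dT) (P : probability T R)
    (omega : T -> Omega d r) (F : T -> site d * int -> upfam d r),
    measurable_fun setT omega ->
    (forall E, measurable E -> P (omega @^-1` E) = mu E) ->
    iid_field ups P F ->
    indep_of_field P omega F ->
    forall (t : nat) (E : set (Omega d r)), measurable E ->
      P [set w | E (window (omega w) (F w) t)] = mu E.

Definition delta0 (R : realType) (d : nat) (r : R) :
    probability (Omega d r) R := \d_(config0 d r : Omega d r).

Definition delta0_unique_invariant (R : realType) (d : nat) (r : R)
    (ups : pca d r) : Prop :=
  invariant_measure ups (delta0 d r) /\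
  forall mu : probability (Omega d r) R, invariant_measure ups mu ->
    forall E, measurable E -> mu E = delta0 d r E.

(* derivative at p relative to [p1, p2], hence one-sided at p1 and p2 *)
Definition diff_quot (R : realType) (f : R -> R) (p q : R) : R :=
  (f q - f p) / (q - p).

Definition deriv_on (R : realType) (p1 p2 : R) (f : R -> R) (p : R) : R :=
  lim (diff_quot f p @ within `[p1, p2] p^').

Definition C1_on (R : realType) (p1 p2 : R) (f : R -> R) : Prop :=
  (forall p, p1 <= p <= p2 -> cvg (diff_quot f p @ within `[p1, p2] p^')) /\
  {within `[p1, p2], continuous (deriv_on p1 p2 f)}.

Definition parametrised_model (R : realType) (d : nat) (r p1 p2 : R)
    (ups : R -> pca d r) : Prop :=
  forall U, C1_on p1 p2 (fun p => ups p U).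

Definition pca_deriv (R : realType) (d : nat) (r p1 p2 : R)
    (ups : R -> pca d r) (p : R) (U : upfam d r) : R :=
  deriv_on p1 p2 (fun q => ups q U) p.

Definition strongly_increasing (R : realType) (d : nat) (r p1 p2 : R)
    (ups : R -> pca d r) : Prop :=
  exists2 c0 : R, 0 < c0 &
    forall D : {set upfam d r}, down_set D ->
      D != finset.set0 -> D != [set: upfam d r]%SET ->
      forall p, p1 <= p <= p2 ->
        meas (pca_deriv p1 p2 ups p) D <= - c0 * (1 - meas (ups p) D).

Definition p_crit (R : realType) (d : nat) (r p1 p2 : R)
    (ups : R -> pca d r) : R :=
  let S := [set p | p1 <= p <= p2 /\ ~ delta0_unique_invariant (ups p)] in
  if `[< S = set0 >] then p2 else inf S.

(* Main.v *)
Require Import Defs.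
From HB Require Import structures.
From mathcomp Require Import all_boot all_order all_algebra.
From mathcomp Require Import finmap.
From mathcomp Require Import all_classical all_reals all_analysis.
From mathcomp Require Import lra ring zify.

(* For p < q < p_c, strong increase integrates (Gronwall on each up-set) to a
   stochastic domination of ups p by the law ups q in which every site is
   moreover closed independently with probability 1 - x, for some x < 1.
   Let theta_n(x) be the probability that the origin survives to time n from all
   ones under this thinned law. By Russo's formula theta_n' is at least the
   expected number of sites whose closure kills the origin at time n. The
   Duminil-Copin--Raoufi--Tassion method applies to x: the O'Donnell--Saks--
   Schramm--Servedio inequality, for the exploration that follows forward in time
   the process started from all ones at a level k <= n, and that looks below
   level k only if this process survives at the origin at time n, yields after
   averaging over k
     n theta_n (1 - theta_n) <= K (1 + theta_0 + ... + theta_{n-1}) theta_n'.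
   Since theta_n(1) -> 0, integrating this inequality three times gives the
   exponential decay of theta_n(x) for every x < 1.
   That theta_n(1) -> 0 at parameter q follows from uniqueness of delta_0: the
   decreasing limit of the processes started from all ones in the distant past
   has an invariant law. The product space carrying the field needs no
   construction: if no iid field with law ups q existed, every measure would be
   (vacuously) invariant, contradicting uniqueness. *)

Import Order.TTheory GRing.Theory Num.Theory.
Import numFieldNormedType.Exports.
Local Open Scope classical_set_scope.
Local Open Scope ring_scope.
Set Implicit Arguments.
Unset Strict Implicit.
Unset Printing Implicit Defensive.

(** * Expectation over finitely many independent coordinates *)

Definition upd (I : eqType) (A : Type) (s : I -> A) (z : I) (a : A) : I -> A :=
  fun y => if y == z then a else s y.

Section Upd.
Context (I : eqType) (A : Type).
Implicit Types (s : I -> A) (z : I) (a : A).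

Lemma upd_same s z a : upd s z a z = a.
Proof. by rewrite /upd eqxx. Qed.

Lemma upd_other s z a y : y != z -> upd s z a y = s y.
Proof. by rewrite /upd => /negbTE->. Qed.

Lemma updK s z a b : upd (upd s z a) z b = upd s z b.
Proof. by apply/funext => y; rewrite /upd; case: eqP. Qed.

Lemma updC s z z' a b : z != z' ->
  upd (upd s z a) z' b = upd (upd s z' b) z a.
Proof.
move=> zz'; apply/funext => y; rewrite /upd.
by case: (y =P z') => // ->; rewrite eq_sym (negbTE zz').
Qed.

End Upd.

Section Expectation.
Context (R : realType) (I : eqType) (A : finType).
Implicit Types (m : A -> R) (l : seq I) (f g : (I -> A) -> R) (s : I -> A).

(* Expectation of f when the coordinates listed in l are independent with mass
   function m and the other coordinates are frozen to the values of s. *)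
Fixpoint Ex m l f s : R :=
  if l is z :: l' then \sum_a m a * Ex m l' f (upd s z a) else f s.

Definition depends_on (T : Type) (K : seq I) (f : (I -> A) -> T) : Prop :=
  forall s s', {in K, s =1 s'} -> f s = f s'.

Lemma Ex_cat m l1 l2 f s : Ex m (l1 ++ l2) f s = Ex m l1 (Ex m l2 f) s.
Proof.
by elim: l1 s => //= z l1 IH s; apply: eq_bigr => a _; rewrite IH.
Qed.

Lemma eq_Ex m l f g s : (forall s', f s' = g s') -> Ex m l f s = Ex m l g s.
Proof. by move=> /funext->. Qed.

Lemma Ex_ext m l f g s :
  (forall s', (forall z, z \notin l -> s' z = s z) -> f s' = g s') ->
  Ex m l f s = Ex m l g s.
Proof.
elim: l s => /= [s fg|z l IH s fg]; first exact: fg.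
apply: eq_bigr => a _; congr (_ * _); apply: IH => s' s's; apply: fg => y.
rewrite inE negb_or => /andP[yz yl]; rewrite s's//.
by rewrite upd_other.
Qed.

Lemma ExD m l f g s : Ex m l (fun s => f s + g s) s = Ex m l f s + Ex m l g s.
Proof.
elim: l s => //= z l IH s; rewrite -big_split/=; apply: eq_bigr => a _.
by rewrite IH mulrDr.
Qed.

Lemma ExZ m l c f s : Ex m l (fun s => c * f s) s = c * Ex m l f s.
Proof.
elim: l s => //= z l IH s; rewrite big_distrr/=; apply: eq_bigr => a _.
by rewrite IH mulrCA.
Qed.

Lemma ExB m l f g s : Ex m l (fun s => f s - g s) s = Ex m l f s - Ex m l g s.
Proof.
rewrite -mulN1r -ExZ -ExD; apply: eq_Ex => s'; by rewrite mulN1r.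
Qed.

Lemma Ex_upd_out m l f s z a : z \notin l ->
  Ex m l (fun s => f (upd s z a)) s = Ex m l f (upd s z a).
Proof.
elim: l s => //= y l IH s; rewrite inE negb_or => /andP[zy zl].
by apply: eq_bigr => b _; rewrite IH// updC// eq_sym.
Qed.

Lemma Ex_swap m z z' l f s : Ex m (z :: z' :: l) f s = Ex m (z' :: z :: l) f s.
Proof.
have [->//|zz'] := eqVneq z z'.
rewrite /=; under eq_bigr do rewrite big_distrr/=.
rewrite exchange_big/=; apply: eq_bigr => b _; rewrite big_distrr/=.
by apply: eq_bigr => a _; rewrite updC// mulrCA.
Qed.

Lemma Ex_mid m l1 z l2 f s : Ex m (l1 ++ z :: l2) f s = Ex m (z :: l1 ++ l2) f s.
Proof.
elim: l1 s => // y l1 IH s.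
transitivity (Ex m (y :: z :: l1 ++ l2) f s); last exact: Ex_swap.
by rewrite /=; apply: eq_bigr => a _; rewrite IH.
Qed.

Lemma Ex_catC m l1 l2 f s : Ex m (l1 ++ l2) f s = Ex m (l2 ++ l1) f s.
Proof.
elim: l1 s => [|z l1 IH] s; first by rewrite cats0.
by rewrite Ex_mid /=; apply: eq_bigr => a _; rewrite IH.
Qed.

Section Mass.
Variable m : A -> R.
Hypotheses (m0 : forall a, 0 <= m a) (m1 : \sum_a m a = 1).

Lemma Ex_cst l c s : Ex m l (fun=> c) s = c.
Proof.
elim: l s => //= z l IH s; under eq_bigr do rewrite IH.
by rewrite -mulr_suml m1 mul1r.
Qed.

Lemma Ex_sum (J : Type) (js : seq J) (f : J -> (I -> A) -> R) l s :
  Ex m l (fun s => \sum_(j <- js) f j s) s = \sum_(j <- js) Ex m l (f j) s.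
Proof.
elim: js => [|j js IH].
  by rewrite big_nil -[RHS](Ex_cst l _ s); apply: eq_Ex => s'; rewrite big_nil.
rewrite big_cons -IH -ExD; apply: eq_Ex => s'; by rewrite big_cons.
Qed.

Lemma le_Ex l f g s : (forall s, f s <= g s) -> Ex m l f s <= Ex m l g s.
Proof.
move=> fg; elim: l s => //= z l IH s; apply: ler_sum => a _.
exact: ler_wpM2l.
Qed.

Lemma Ex_ge0 l f s : (forall s, 0 <= f s) -> 0 <= Ex m l f s.
Proof. by move=> f0; rewrite -(Ex_cst l 0 s); exact: le_Ex. Qed.

Lemma Ex_le1 l f s : (forall s, f s <= 1) -> Ex m l f s <= 1.
Proof. by move=> f1; rewrite -(Ex_cst l 1 s); exact: le_Ex. Qed.

(** Conditioning on the coordinate z. The last draw of a coordinate overwrites earlier ones, so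
    repetitions in [l] are harmless. *)
Lemma Ex_resample z l f s : z \in l ->
  Ex m l f s = \sum_a m a * Ex m l (fun s => f (upd s z a)) s.
Proof.
elim: l s => //= y l IH s; have [zl _|zl] := boolP (z \in l).
  under eq_bigr do rewrite IH// big_distrr/=.
  rewrite exchange_big/=; apply: eq_bigr => a _; rewrite big_distrr/=.
  by apply: eq_bigr => b _; rewrite mulrCA.
rewrite inE (negbTE zl) orbF => /eqP<-; apply: eq_bigr => a _; congr (_ * _).
under eq_bigr do rewrite Ex_upd_out// updK.
by rewrite -mulr_suml m1 mul1r.
Qed.

Lemma Ex_dep l f s s' : (forall t t', (forall y, y \notin l -> t y = s y) ->
    (forall y, y \notin l -> t' y = s' y) -> {in l, t =1 t'} -> f t = f t') ->
  Ex m l f s = Ex m l f s'.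
Proof.
elim: l s s' => /= [s s' h|z l IH s s' h]; first by apply: h => // y; rewrite inE.
apply: eq_bigr => a _; congr (_ * _); apply: IH => t t' ts t's' tt'.
apply: h.
- by move=> y; rewrite inE negb_or => /andP[yz yl]; rewrite ts// upd_other.
- by move=> y; rewrite inE negb_or => /andP[yz yl]; rewrite t's'// upd_other.
- move=> y; rewrite inE => /predU1P[->|]; last exact: tt'.
  have [zl|zl] := boolP (z \in l); first exact: tt'.
  by rewrite ts// t's'// !upd_same.
Qed.

(** Integrating over [l' ++ l] in either order meets an inner integral that is already constant, so
    both sides equal this double expectation. *)
Lemma Ex_indep K l l' f s s' : depends_on K f ->
  {subset K <= l} -> {subset K <= l'} -> Ex m l f s = Ex m l' f s'.
Proof.
move=> fK Kl Kl'.
have cst k (t t' : I -> A) : {subset K <= k} -> Ex m k f t = Ex m k f t'.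
  by move=> Kk; apply: Ex_dep => u u' _ _ uu'; apply: fK => y /Kk; exact: uu'.
have -> : Ex m l f s = Ex m (l' ++ l) f s'.
  rewrite Ex_cat -(Ex_cst l' (Ex m l f s) s'); apply: eq_Ex => t; exact: cst.
rewrite Ex_catC Ex_cat -(Ex_cst l (Ex m l' f s') s').
by apply: eq_Ex => t; exact: cst.
Qed.

(** With [c := clean], this removes the empty set from all families at no cost when the families
    containing it have mass zero. *)
Lemma Ex_comp_fix (c : A -> A) l f s : (forall a, m a != 0 -> c a = a) ->
  (forall z, c (s z) = s z) -> Ex m l f s = Ex m l (fun s => f (c \o s)) s.
Proof.
move=> ca; elim: l s => /= [s cs|z l IH s cs].
  by congr f; apply/funext => z /=; rewrite cs.
apply: eq_bigr => a _; have [->|/ca caa] := eqVneq (m a) 0; first by rewrite !mul0r.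
by rewrite IH// => y; rewrite /upd; case: eqP.
Qed.

Lemma Ex_map (t t' : I -> I) l f s : cancel t t' -> cancel t' t ->
  Ex m (map t l) f s = Ex m l (fun s => f (s \o t')) (s \o t).
Proof.
move=> tK t'K; elim: l s => /= [s|z l IH s].
  by congr f; apply/funext => y /=; rewrite t'K.
apply: eq_bigr => a _; rewrite IH; congr (_ * Ex m _ _ _).
by apply/funext => y; rewrite /= /upd (inj_eq (can_inj tK)).
Qed.

End Mass.

Section Monotone.
Variable le : rel A.
Hypothesis le_refl : reflexive le.

Definition ex_mono f : Prop :=
  forall s s', (forall z, le (s z) (s' z)) -> f s <= f s'.

Lemma Ex_mono m l f : (forall a, 0 <= m a) -> ex_mono f -> ex_mono (Ex m l f).
Proof.
move=> m0 fm; elim: l => //= z l IH s s' ss'; apply: ler_sum => a _.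
apply: ler_wpM2l => //; apply: IH => y; rewrite /upd; case: eqP => // _.
Qed.

(** Coordinates pass from [m] to [m'] one at a time; averaging the others keeps f monotone, so the
    one-coordinate domination applies each time. *)
Lemma Ex_dominated m m' l f s :
  (forall a, 0 <= m a) -> (forall a, 0 <= m' a) -> ex_mono f ->
  (forall h : A -> R, (forall a b, le a b -> h a <= h b) ->
    \sum_a m a * h a <= \sum_a m' a * h a) ->
  Ex m l f s <= Ex m' l f s.
Proof.
move=> m0 m'0 fm dom; elim: l s => //= z l IH s.
apply: (@le_trans _ _ (\sum_a m a * Ex m' l f (upd s z a))).
  by apply: ler_sum => a _; exact: ler_wpM2l.
apply: dom => a b ab; apply: Ex_mono => // y; rewrite /upd; case: eqP => //.
Qed.

Lemma Ex_ge_bot m l f s : (forall a, 0 <= m a) -> \sum_a m a = 1 ->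
  ex_mono f -> (forall z a, le (s z) a) -> f s <= Ex m l f s.
Proof.
move=> m0 m1 fm sb; rewrite -[leLHS](Ex_cst m1 l (f s) s).
by apply: le_Ex => // t; apply: fm => z; exact: sb.
Qed.

(** Drawing further coordinates, until now frozen at a minimal value, can only raise a monotone f;
    [l] itself may miss part of [K]. *)
Lemma Ex_le_cover m K l l' f s : (forall a, 0 <= m a) -> \sum_a m a = 1 ->
  ex_mono f -> (forall z a, le (s z) a) ->
  depends_on K f -> {subset K <= l'} -> Ex m l f s <= Ex m l' f s.
Proof.
move=> m0 m1 fm sb fK Kl'.
rewrite (@Ex_indep _ m1 K l' (l' ++ l) f s s fK)//; last first.
  by move=> y /Kl'; rewrite mem_cat => ->.
by rewrite Ex_cat; apply: Ex_ge_bot => //; exact: Ex_mono.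
Qed.

End Monotone.
End Expectation.

(** * The OSSS inequality and Russo's formula *)

Section OSSS.
Context (R : realType) (I : eqType) (A : finType).
Variables (m : A -> R) (bot : A) (L : seq I) (s0 : I -> A).
Hypotheses (m0 : forall a, 0 <= m a) (m1 : \sum_a m a = 1).
Variables (rank : I -> nat) (S : I -> (I -> A) -> bool) (F g : (I -> A) -> R).
Hypothesis F01 : forall s, 0 <= F s <= 1.
Hypothesis g_bot : forall s z, g (upd s z bot) <= g s.
Hypothesis S_rank : forall z s s',
  (forall y, (rank y < rank z)%N -> s y = s' y) -> S z s = S z s'.
Hypothesis F_unrevealed : forall z s a, ~~ S z s -> F (upd s z a) = F s.
Hypothesis S_unrevealed : forall z s a z',
  ~~ S z s -> S z' (upd s z a) = S z' s.

Let E f := Ex m L f s0.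

(** Hybrid configuration seen by F: the sites still to be examined are shared with the configuration
    x seen by g, those already examined are frozen in s. It interpolates between a full coupling of
    F and g and independence. *)
Definition mix (l : seq I) (s x : I -> A) : I -> A :=
  fun y => if y \in l then x y else s y.

Lemma mix_cons z l s x : mix (z :: l) s x = upd (mix l s x) z (x z).
Proof.
by apply/funext => y; rewrite /mix /upd inE; case: eqP => // ->.
Qed.

Lemma mix_cons_upd z l s x a : z \notin l ->
  mix (z :: l) s (upd x z a) = mix l (upd s z a) x.
Proof.
move=> zl; apply/funext => y; rewrite /mix /upd inE; case: (y =P z) => //= ->.
by rewrite (negbTE zl).
Qed.

(* Sites are examined in the order of l; S z s tells whether z is revealed, and
   F only depends on revealed sites. A revealed site contributes to the
   covariance at most the effect of closing it. *)
Lemma osss_rec l s : uniq l -> {subset l <= L} ->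
  sorted (fun y z => (rank y <= rank z)%N) l ->
  E (fun x => F (mix l s x) * g x) - E (fun x => F (mix l s x)) * E g <=
  \sum_(z <- l) E (fun x => (S z (mix l s x))%:R) *
    (E g - E (fun x => g (upd x z bot))).
Proof.
have EFg0 : E g - 0 = E g by rewrite subr0.
elim: l s => [s _ _ _|z l IH s /= /andP[zl ul] lL srt].
  have -> : mix [::] s = fun=> s by [].
  by rewrite big_nil /E ExZ Ex_cst// subrr.
have zL : z \in L by apply: lL; rewrite mem_head.
have lL' : {subset l <= L} by move=> y yl; apply: lL; rewrite inE yl orbT.
have srt' := path_sorted srt.
have rk : all (fun y => (rank z <= rank y)%N) l.
  apply: order_path_min srt => x y w; exact: leq_trans.
have Smix (k : seq I) x : {subset k <= z :: l} -> S z (mix k s x) = S z s.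
  move=> kl; apply: S_rank => y yz; rewrite /mix; case: ifPn => // /kl.
  rewrite inE => /predU1P[yE|/(allP rk)]; first by rewrite yE ltnn in yz.
  by rewrite leqNgt yz.
have Szl x : S z (mix (z :: l) s x) = S z s by exact: Smix.
have Sl x : S z (mix l s x) = S z s.
  by apply: Smix => y yl; rewrite inE yl orbT.
rewrite big_cons; have -> : E (fun x => (S z (mix (z :: l) s x))%:R) = (S z s)%:R.
  by rewrite /E -[RHS](Ex_cst m1 L _ s0); apply: eq_Ex => x; rewrite Szl.
(* An unrevealed site affects neither F nor the later decisions, so it leaves the hybrid for
   free. *)
have [Sz|nSz] := boolP (S z s); last first.
  rewrite mul0r add0r.
  have FE : (fun x => F (mix (z :: l) s x)) = (fun x => F (mix l s x)).
    by apply/funext => x; rewrite mix_cons F_unrevealed// Sl.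
  have FE2 : (fun x => F (mix (z :: l) s x) * g x) = (fun x => F (mix l s x) * g x).
    by apply/funext => x; rewrite mix_cons F_unrevealed// Sl.
  rewrite FE FE2; apply: (le_trans (IH s ul lL' srt')).
  apply: ler_sum => z' _.
  have -> // : (fun x => (S z' (mix (z :: l) s x))%:R : R) =
    (fun x => (S z' (mix l s x))%:R).
  by apply/funext => x; rewrite mix_cons S_unrevealed// Sl.
rewrite mul1r.
pose piv := E g - E (fun x => g (upd x z bot)); rewrite -/piv.
have resF f : E (fun x => f (mix (z :: l) s x)) =
    \sum_a m a * E (fun x => f (mix l (upd s z a) x)).
  rewrite /E (Ex_resample m1 _ _ zL); apply: eq_bigr => a _; congr (_ * _).
  by apply: eq_Ex => x; rewrite mix_cons_upd.
(* Decoupling z: g returns to its own value at z while F keeps a. Since 0 <= F <= 1 and closing z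
   only lowers g, the error is at most [g (upd x z a) - g (upd x z bot)], whose mean is [piv]. *)
have resFg : E (fun x => F (mix (z :: l) s x) * g x) <=
    \sum_a m a * E (fun x => F (mix l (upd s z a) x) * g x) + piv.
  rewrite {1}/E (Ex_resample m1 _ _ zL).
  have -> : piv = \sum_a m a * E (fun x => g (upd x z a) - g (upd x z bot)).
    under eq_bigr do rewrite /E ExB mulrBr.
    rewrite big_split/= /piv sumrN -mulr_suml m1 mul1r; congr (_ - _).
    by rewrite {1}/E (Ex_resample m1 _ _ zL).
  rewrite -big_split/=; apply: ler_sum => a _; rewrite -mulrDr.
  apply: ler_wpM2l => //; rewrite -ExD; apply: le_Ex => // x.
  rewrite mix_cons_upd// -lerBlDl -mulrBr.
  have /andP[F0 F1] := F01 (mix l (upd s z a) x).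
  apply: (@le_trans _ _ (F (mix l (upd s z a) x) * (g (upd x z a) - g (upd x z bot)))).
    by apply: ler_wpM2l => //; rewrite lerB.
  apply: ler_piMl => //; rewrite subr_ge0.
  by rewrite -[upd x z bot](updK x z a bot); exact: g_bot.
rewrite (resF F); apply: (le_trans (lerB resFg (lexx _))).
rewrite addrAC [leLHS]addrC lerD2l mulr_suml -sumrB.
have -> : \sum_(z' <- l) E (fun x => (S z' (mix (z :: l) s x))%:R) *
    (E g - E (fun x => g (upd x z' bot))) =
  \sum_a m a * \sum_(z' <- l) E (fun x => (S z' (mix l (upd s z a) x))%:R) *
    (E g - E (fun x => g (upd x z' bot))).
  under [RHS]eq_bigr do rewrite big_distrr/=.
  rewrite exchange_big/=; apply: eq_bigr => z' _.
  rewrite (resF (fun x => (S z' x)%:R)) mulr_suml.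
  by apply: eq_bigr => a _; rewrite mulrA.
apply: ler_sum => a _; rewrite -mulrA -mulrBr; apply: ler_wpM2l => //.
exact: IH.
Qed.

(** In the list sorted by rank, whether a site is revealed is decided by sites of smaller rank;
    [mix l s0 x] agrees with x on L, so [osss_rec] starts from the full covariance. *)
Lemma osss : uniq L ->
  E (fun x => F x * g x) - E F * E g <=
  \sum_(z <- L) E (fun x => (S z x)%:R) * (E g - E (fun x => g (upd x z bot))).
Proof.
move=> uL; pose l := sort (fun y z => (rank y <= rank z)%N) L.
have pl : perm_eq l L by rewrite perm_sort.
have ml : l =i L by exact: perm_mem.
have EE f : E f = E (fun x => f (mix l s0 x)).
  apply: Ex_ext => x xs; congr f; apply/funext => y; rewrite /mix ml.
  by case: ifPn => // /xs.
rewrite (EE F) (EE (fun x => F x * g x)).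
have -> : E (fun x => F (mix l s0 x) * g (mix l s0 x)) =
    E (fun x => F (mix l s0 x) * g x).
  rewrite [RHS]EE; apply: eq_Ex => x; congr (F _ * _); apply/funext => y.
  by rewrite /mix; case: ifP.
have srt : sorted (fun y z => (rank y <= rank z)%N) l.
  by apply: sort_sorted => y z; exact: leq_total.
have ul : uniq l by rewrite sort_uniq.
have lL : {subset l <= L} by move=> y; rewrite ml.
apply: (le_trans (osss_rec s0 ul lL srt)).
rewrite (perm_big _ pl)/=; apply: ler_sum => z _.
by rewrite -(EE (fun x => (S z x)%:R)).
Qed.

End OSSS.

Section Russo.
Context (R : realType) (I : eqType) (A : finType).
Variables (m : A -> R) (bot : A).

(* m-mass of a family that is replaced by bot with probability 1 - x *)
Definition thin (x : R) (a : A) : R := x * m a + (1 - x) * (a == bot)%:R.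

Lemma thin1 : thin 1 = m.
Proof. by apply/funext => a; rewrite /thin mul1r subrr mul0r addr0. Qed.

Lemma sum_thin x (h : A -> R) :
  \sum_a thin x a * h a = x * (\sum_a m a * h a) + (1 - x) * h bot.
Proof.
rewrite /thin; under eq_bigr do rewrite mulrDl.
rewrite big_split/= big_distrr/=; congr (_ + _).
  by apply: eq_bigr => a _; rewrite mulrA.
rewrite (bigD1 bot)//= eqxx mulr1 big1 ?addr0// => a /negbTE->.
by rewrite mulr0 mul0r.
Qed.

Lemma thin_ge0 x a : (forall a, 0 <= m a) -> 0 <= x <= 1 -> 0 <= thin x a.
Proof.
move=> m0 /andP[x0 x1]; rewrite addr_ge0// mulr_ge0// ?subr_ge0//.
Qed.

Lemma thin_sum1 x : \sum_a m a = 1 -> \sum_a thin x a = 1.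
Proof.
move=> m1; have := sum_thin x (fun=> 1).
under eq_bigr do rewrite mulr1; move=> ->.
by under eq_bigr do rewrite mulr1; rewrite m1 !mulr1 addrC subrK.
Qed.

(** Derivative of [Ex (thin x)] by the product rule: the first term differentiates the weight of z,
    whose derivative is [m a - (a == bot)]. *)
Fixpoint dEx (x : R) (l : seq I) (f : (I -> A) -> R) (s : I -> A) : R :=
  if l is z :: l' then
    (\sum_a m a * Ex (thin x) l' f (upd s z a) - Ex (thin x) l' f (upd s z bot))
    + \sum_a thin x a * dEx x l' f (upd s z a)
  else 0.

Lemma is_derive_Ex (x : R) l f s :
  is_derive x (1 : R) (fun y : R => Ex (thin y) l f s) (dEx x l f s).
Proof.
elim: l s => [|z l IH] s /=; first exact: is_derive_cst.
have -> : (fun y => \sum_a thin y a * Ex (thin y) l f (upd s z a)) =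
  \sum_a (fun y => thin y a * Ex (thin y) l f (upd s z a)).
  by apply/funext => y; rewrite fct_sumE.
have -> : \sum_a m a * Ex (thin x) l f (upd s z a) - Ex (thin x) l f (upd s z bot)
    + \sum_a thin x a * dEx x l f (upd s z a) =
  \sum_a (thin x a * dEx x l f (upd s z a) +
    (m a - (a == bot)%:R) * Ex (thin x) l f (upd s z a)).
  rewrite big_split/= addrC; congr (_ + _).
  under [RHS]eq_bigr do rewrite mulrBl.
  rewrite sumrB; congr (_ - _); rewrite (bigD1 bot)//= eqxx mul1r big1 ?addr0//.
  by move=> a /negbTE->; rewrite mul0r.
elim/big_ind2 : _ => [|f1 d1 f2 d2 h1 h2|a _].
- exact: is_derive_cst.
- exact: is_deriveD.
have dt : is_derive x (1 : R) (fun y : R => thin y a) (m a - (a == bot)%:R).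
  rewrite /thin; apply: is_derive_eq. rewrite /GRing.scale/=. ring.
have := @is_deriveM _ _ _ _ x (1 : R) _ _ dt (IH (upd s z a)).
by move=> h; apply: (is_derive_eq h); rewrite /GRing.scale/= [_ * (m a - _)]mulrC.
Qed.

(** Since x (m - delta_bot) = [thin x] - delta_bot, the factor x turns each term of the derivative
    into the effect of closing one site. *)
Lemma russo x l f s : \sum_a m a = 1 -> uniq l ->
  x * dEx x l f s = \sum_(z <- l)
    (Ex (thin x) l f s - Ex (thin x) l (fun t => f (upd t z bot)) s).
Proof.
move=> m1; have t1 := thin_sum1 x m1.
elim: l s => [|z l IH] s /=; first by rewrite big_nil mulr0.
move=> /andP[zl ul]; rewrite big_cons mulrDr; congr (_ + _).
  rewrite sum_thin.
  under [X in _ = _ - X]eq_bigr do rewrite Ex_upd_out// updK.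
  by rewrite -mulr_suml t1; ring.
rewrite big_distrr/=.
under eq_bigr do rewrite mulrCA IH//.
under eq_bigr do rewrite big_distrr/=.
rewrite exchange_big/=; apply: eq_bigr => y _.
by under eq_bigr do rewrite mulrBr; rewrite sumrB.
Qed.

End Russo.

(** * Up-families and the combinatorics of the process *)

Section UpFamilies.
Context (R : realType) (d : nat) (r : R).
Implicit Types (U V : upfam d r) (X Y : {set nbh d r}).

Lemma up_closedP (U : {set {set nbh d r}}) :
  (forall X Y, X \in U -> X \subset Y -> Y \in U) -> up_closed U.
Proof.
move=> h; apply/forallP => X; apply/forallP => Y; apply/implyP => /andP[].
exact: h.
Qed.

Lemma upfam_up U X Y : X \in val U -> X \subset Y -> Y \in val U.
Proof.
move=> XU XY; have := valP U => /forallP/(_ X)/forallP/(_ Y)/implyP; apply.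
by rewrite XU XY.
Qed.

Definition leU U V := val U \subset val V.

Lemma leU_refl : reflexive leU.
Proof. by move=> U; exact: subxx. Qed.

Lemma up_closed0 : up_closed (finset.set0 : {set {set nbh d r}}).
Proof. by apply: up_closedP => X Y; rewrite finset.inE. Qed.

Definition botU : upfam d r :=
  exist (fun U : {set {set nbh d r}} => up_closed U) _ up_closed0.

Lemma up_closedT : up_closed ([set: {set nbh d r}]%SET).
Proof. by apply: up_closedP => X Y; rewrite !finset.inE. Qed.

Definition topU : upfam d r :=
  exist (fun U : {set {set nbh d r}} => up_closed U) _ up_closedT.

Lemma up_closed_clean U : up_closed (val U :\ finset.set0).
Proof.
apply: up_closedP => X Y; rewrite !finset.inE => /andP[X0 XU] XY.
rewrite (upfam_up XU XY) andbT; apply: contra X0 => /eqP Y0.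
by rewrite -finset.subset0 -Y0.
Qed.

Definition clean U : upfam d r :=
  exist (fun U : {set {set nbh d r}} => up_closed U) _ (up_closed_clean U).

Lemma in_clean U X : (X \in val (clean U)) = (X != finset.set0) && (X \in val U).
Proof. by rewrite /= !finset.inE. Qed.

Lemma clean_bot : clean botU = botU.
Proof. by apply: val_inj; rewrite /= finset.set0D. Qed.

Lemma clean_le U V : leU U V -> leU (clean U) (clean V).
Proof. exact: finset.setSD. Qed.

Lemma clean_id U : finset.set0 \notin val U -> clean U = U.
Proof.
move=> U0; apply: val_inj => /=; apply/finset.setP => X.
by rewrite !finset.inE; case: eqP => // ->; rewrite (negbTE U0).
Qed.

Lemma botU_le U : leU botU U.
Proof. exact: finset.sub0set. Qed.

Lemma leU_top U : leU U topU.
Proof. exact: finset.subsetT. Qed.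

End UpFamilies.
Arguments botU {R d r}.
Arguments topU {R d r}.

(** Induction following the recursion of the process: negative times carry the initial condition. *)
Lemma time_ind (Q : int -> Prop) : (forall s, s < 0 -> Q s) ->
  (forall t : nat, (forall s, s < t%:Z -> Q s) -> Q t) -> forall s, Q s.
Proof.
move=> Qneg Qnat; have H n : forall s, s < n%:Z -> Q s.
  elim: n => [//|n IH s]; rewrite -addn1 PoszD ltzD1 le_eqVlt.
  by move=> /predU1P[->|]; [exact: Qnat|exact: IH].
by move=> s; apply: (H `|s|.+1); lia.
Qed.

Section Process.
Context (R : realType) (d : nat) (r : R).
Implicit Types (w : config d r) (F : site d * int -> upfam d r).

Lemma nbh_lt0 (y : nbh d r) : (val y).2 < 0.
Proof.
by have := fsvalP y; rewrite mem_nbh => /andP[_ /andP[_]]; rewrite ltrz0.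
Qed.

Lemma nbh_time (y : nbh d r) (t : nat) : t%:Z + (val y).2 < t%:Z.
Proof. by rewrite gtrDl; exact: nbh_lt0. Qed.

Lemma nbh_past (y : nbh d r) (t : nat) : t%:Z + (val y).2 < 0 ->
  t%:Z + (val y).2 \in past r.
Proof.
have := fsvalP y; rewrite mem_nbh => /andP[_ /andP[h _]] ty.
by rewrite mem_past ltrz0 ty andbT (le_trans h)// ler_int lerDr.
Qed.

Lemma past_time (u : past r) (k : nat) : k%:Z + val u < k%:Z.
Proof.
by have := fsvalP u; rewrite mem_past ltrz0 gtrDl => /andP[].
Qed.

Lemma past_or_nonneg (u : past r) (k : nat) :
  (0 <= k%:Z + val u) || (k%:Z + val u \in past r).
Proof.
case: leP => //= ku; have := fsvalP u; rewrite !mem_past => /andP[h _].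
by rewrite ltrz0 ku andbT (le_trans h)// ler_int lerDr.
Qed.

Lemma pca_eta_neg w F x (s : int) : s < 0 ->
  pca_eta w F x s = (if insub s is Some u then w (x, u) else false).
Proof. by move=> s0; rewrite -(@pca_eta_uptoE _ _ _ w F 0 x s). Qed.

Definition nbh_on w F (z : site d * int) : {set nbh d r} :=
  [set y : nbh d r | pca_eta w F (z.1 + (val y).1) (z.2 + (val y).2)]%SET.

Lemma pca_eta_nextE w F x (t : nat) :
  pca_eta w F x t = (nbh_on w F (x, t%:Z) \in val (F (x, t%:Z))).
Proof. exact: pca_eta_next. Qed.

Lemma pca_eta_mono w w' F F' : (forall z, w z -> w' z) ->
  (forall z, leU (F z) (F' z)) ->
  forall s x, pca_eta w F x s -> pca_eta w' F' x s.
Proof.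
move=> ww FF; elim/time_ind => [s s0 x|t IH x].
  by rewrite !pca_eta_neg//; case: insub => // u; exact: ww.
rewrite !pca_eta_nextE => /(fintype.subsetP (FF _)) h; apply: (upfam_up h).
by apply/fintype.subsetP => y; rewrite !finset.inE; apply: IH; exact: nbh_time.
Qed.

Lemma eq_in_val (X Y : {set nbh d r}) (U V : upfam d r) :
  X = Y -> U = V -> (X \in val U) = (Y \in val V).
Proof. by move=> -> ->. Qed.

Lemma eq_pca_eta w F F' (T : int) :
  (forall z, 0 <= z.2 -> z.2 <= T -> F z = F' z) ->
  forall s x, s <= T -> pca_eta w F x s = pca_eta w F' x s.
Proof.
move=> FF; elim/time_ind => [s s0 x _|t IH x tT]; first by rewrite !pca_eta_neg.
rewrite !pca_eta_nextE; apply: eq_in_val; last exact: FF.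
apply/finset.setP => y.
rewrite !finset.inE; apply: IH; first exact: nbh_time.
by rewrite (le_trans _ tT)// ltW// nbh_time.
Qed.

(** Backward light cone. The fuel n suffices once it exceeds the time of z, since each neighbour
    lies at least one time unit earlier. *)
Fixpoint cone (n : nat) (z : site d * int) : seq (site d * int) :=
  if n is n'.+1 then
    if z.2 < 0 then [::] else
    z :: flatten [seq cone n' (z + val y) | y : nbh d r]
  else [::].

Lemma cone_time n z z' : z' \in cone n z -> 0 <= z'.2 <= z.2.
Proof.
elim: n z => //= n IH z; case: ltP => // z0; rewrite inE => /predU1P[->|].
  by rewrite z0 lexx.
move=> /flatten_mapP[y _ /IH /andP[-> h]] /=.
by apply: (le_trans h) => /=; rewrite gerDl ltW// nbh_lt0.
Qed.

Lemma pca_eta_cone w n z : z.2 < n%:Z ->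
  depends_on (cone n z) (fun F => pca_eta w F z.1 z.2).
Proof.
elim: n z => [|n IH] [x s] sn F F' FF; first by rewrite !pca_eta_neg.
have [s0|s0] := ltP s 0; first by rewrite !pca_eta_neg.
move: FF; rewrite /= ltNge s0 /= => FF.
case: s => // s in sn s0 FF *.
rewrite !pca_eta_nextE; apply: eq_in_val; last by rewrite FF// mem_head.
apply/finset.setP => y; rewrite !finset.inE.
apply: (IH ((x, Posz s) + val y)) => /=.
  apply: (lt_le_trans (nbh_time y s)).
  by move: sn; rewrite !ltz_nat ltnS lez_nat.
move=> z zy; apply: FF; rewrite inE; apply/orP; right.
by apply/flatten_mapP; exists y => //; rewrite mem_enum.
Qed.

Definition field_shift (v : site d * int) F : site d * int -> upfam d r :=
  fun z => F (z + v).

(** Markov property: the process restarts at time n from its window. The condition on s keeps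
    [n%:Z + s] within the times that the window records or that follow it. *)
Lemma pca_eta_window w F n s x : (0 <= s) || (s \in past r) ->
  pca_eta w F x (n%:Z + s) = pca_eta (window w F n) (field_shift (0, n%:Z) F) x s.
Proof.
move: s x; elim/time_ind => [s s0 x|t IH x _].
  rewrite leNgt s0/= => sp; rewrite [RHS]pca_eta_neg//.
  by case: insubP => [u _ <-//|]; rewrite sp.
rewrite -PoszD !pca_eta_nextE; apply: eq_in_val; last first.
  by congr (F (_, _)); rewrite /= ?addr0// PoszD addrC.
apply/finset.setP => y; rewrite !finset.inE /= PoszD -addrA; apply: IH.
  exact: nbh_time.
by case: leP => //= /nbh_past.
Qed.

Lemma pca_eta_shift F x v s : pca_eta (config1 d r) F (x + v) s =
  pca_eta (config1 d r) (field_shift (v, 0) F) x s.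
Proof.
move: s x; elim/time_ind => [s s0 x|t IH x]; first by rewrite !pca_eta_neg.
rewrite !pca_eta_nextE; apply: eq_in_val; last first.
  by congr (F (_, _)); rewrite /= addr0.
apply/finset.setP => y; rewrite !finset.inE /=.
by rewrite -addrA [v + _]addrC addrA IH//; exact: nbh_time.
Qed.

End Process.

(** * Processes restarted from all ones at a given level *)

Section Levels.
Context (R : realType) (d : nat) (r : R).
Implicit Types (s : site d * int -> upfam d r) (z : site d * int) (k : nat).

(* eta_from k s z is the value at z of the process started from all ones just
   before time k, for the field s in which the empty set is removed from every
   family so that zero is absorbing. *)
Definition cut k s z : upfam d r := if z.2 < k%:Z then topU else clean (s z).

Definition eta_from k s z : bool := pca_eta (config1 d r) (cut k s) z.1 z.2.

Definition live k s z : bool := nbh_on (config1 d r) (cut k s) z != finset.set0.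

Lemma eta_from_initial k s x (u : int) : (0 <= u) || (u \in past r) -> u < k%:Z ->
  eta_from k s (x, u).
Proof.
move=> u0 uk; have [u0'|u0'] := ltP u 0.
  have up : u \in past r by rewrite leNgt u0' in u0.
  by rewrite /eta_from pca_eta_neg//=; case: insubP => //; rewrite up.
case: u u0' uk {u0} => // t _ tk.
by rewrite /eta_from /= pca_eta_nextE /cut tk finset.inE.
Qed.

(** Being full before level k, the restarted process dominates the one started at time 0. *)
Lemma eta_from_level0 k s z : eta_from 0 s z -> eta_from k s z.
Proof.
apply: pca_eta_mono => // y; rewrite /cut; case: ifPn => [y0|_].
  by rewrite (lt_le_trans y0)//; exact: leU_refl.
case: ifP => _; [exact: leU_top|exact: leU_refl].
Qed.

Lemma eta_from_mono k s s' z : (forall z, leU (s z) (s' z)) ->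
  eta_from k s z -> eta_from k s' z.
Proof.
move=> ss; apply: pca_eta_mono => // y; rewrite /cut.
by case: ifP => _; [exact: leU_refl|exact: clean_le].
Qed.

Lemma eq_eta_from k s s' z :
  (forall y, k%:Z <= y.2 -> y.2 <= z.2 -> s y = s' y) ->
  eta_from k s z = eta_from k s' z.
Proof.
move=> ss; apply: (@eq_pca_eta _ _ _ _ _ _ z.2) => // y y0 yz; rewrite /cut.
by case: ltP => // ky; rewrite ss.
Qed.

Lemma liveP k s z : reflect
  (exists y : nbh d r, eta_from k s (z + val y)) (live k s z).
Proof.
apply: (iffP (finset.set0Pn _)) => [[y]|[y]].
  by rewrite finset.inE => h; exists y.
by move=> h; exists y; rewrite finset.inE.
Qed.

Lemma eq_live k s s' z :
  (forall y, k%:Z <= y.2 -> y.2 < z.2 -> s y = s' y) ->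
  live k s z = live k s' z.
Proof.
move=> ss; have E (y : nbh d r) : eta_from k s (z + val y) = eta_from k s' (z + val y).
  apply: eq_eta_from => u ku uz; apply: ss => //; apply: (le_lt_trans uz) => /=.
  by rewrite gtrDl; exact: nbh_lt0.
by apply/liveP/liveP => -[y yh]; exists y; rewrite ?E// -?E.
Qed.

(** Before level k the family is overwritten by [topU]; at an empty neighbourhood a cleaned family
    closes the site whatever it is. *)
Lemma eta_from_upd k s z U y : (z.2 < k%:Z) || ~~ live k s z ->
  eta_from k (upd s z U) y = eta_from k s y.
Proof.
move=> zk; case: y => x u; rewrite /eta_from /=.
move: u x; elim/time_ind => [u u0 x|t IH x]; first by rewrite !pca_eta_neg.
rewrite !pca_eta_nextE.
have NE : nbh_on (config1 d r) (cut k (upd s z U)) (x, t%:Z) =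
    nbh_on (config1 d r) (cut k s) (x, t%:Z).
  apply/finset.setP => y; rewrite !finset.inE; apply: IH; exact: nbh_time.
rewrite NE /cut; case: ltP => //= kt; rewrite /upd; case: eqP => // zE.
move: zk; rewrite -zE ltNge kt/= /live negbK => /eqP->.
by rewrite !finset.inE eqxx.
Qed.

Lemma eta_from_shift k s x (j : nat) :
  eta_from k s (x, k%:Z + j%:Z) = eta_from 0 (field_shift (x, k%:Z) s) (0, j%:Z).
Proof.
rewrite /eta_from /= pca_eta_window//.
have -> : window (config1 d r) (cut k s) k = config1 d r.
  apply/funext => -[y u]; apply: (@eta_from_initial k s y (k%:Z + val u)).
    exact: past_or_nonneg.
  exact: past_time.
rewrite -[x in LHS]add0r pca_eta_shift; congr pca_eta.
apply/funext => z; rewrite /field_shift /cut /= addr0 gtrDr; case: ifP => // _.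
by congr (clean (s _)); rewrite -addrA; congr (_ + (_, _)); rewrite /= ?addr0 ?add0r.
Qed.

Lemma eta_from_cone k n z : z.2 < n%:Z ->
  depends_on (cone r n z) (fun s => eta_from k s z).
Proof.
move=> zn s s' ss; apply: (pca_eta_cone (config1 d r) zn) => y yz.
by rewrite /cut ss.
Qed.

End Levels.

(** * Revealment of the level explorations *)

Section SurvivalProbability.
Context (R : realType) (d : nat) (r : R).
Variable m : upfam d r -> R.
Hypotheses (m0 : forall U, 0 <= m U) (m1 : \sum_U m U = 1).
Implicit Types (s : site d * int -> upfam d r) (n k j : nat).

Definition origin_cone n : seq (site d * int) := undup (cone r n.+1 (0, n%:Z)).

Definition closed : site d * int -> upfam d r := fun=> botU.

Definition theta n : R :=
  Ex m (origin_cone n) (fun s => (eta_from 0 s (0, n%:Z))%:R) closed.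

Lemma theta_ge0 n : 0 <= theta n.
Proof. by apply: Ex_ge0 => // s; rewrite ler0n. Qed.

Lemma theta_le1 n : theta n <= 1.
Proof. by apply: Ex_le1 => // s; rewrite lern1 leq_b1. Qed.

Lemma eta_from_ex_mono k z :
  ex_mono (@leU R d r) (fun s => (eta_from k s z)%:R : R).
Proof.
move=> s s' ss; rewrite ler_nat.
have := @eta_from_mono R d r k s s' z ss.
by case: (eta_from k s z) => // ->.
Qed.

(** Translating (x, k) to the origin of space-time gives [theta j]. It is only an upper bound
    because [l] may miss part of the cone, and missing sites are closed. *)
Lemma Ex_eta_from_le l k x j :
  Ex m l (fun s => (eta_from k s (x, k%:Z + j%:Z))%:R) closed <= theta j.
Proof.
pose K := map (fun z => z + (x, k%:Z)) (origin_cone j).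
have dK : depends_on K (fun s => (eta_from k s (x, k%:Z + j%:Z))%:R : R).
  move=> s s' ss.
  suff -> : eta_from k s (x, k%:Z + j%:Z) = eta_from k s' (x, k%:Z + j%:Z) by [].
  rewrite (eta_from_shift k s x j) (eta_from_shift k s' x j).
  apply: (@eta_from_cone _ _ _ 0 j.+1 (0, j%:Z)) => [|z zj].
    by rewrite /= ltz_nat ltnSn.
  apply: ss.
  by apply/mapP; exists z => //; rewrite mem_undup.
apply: (@le_trans _ _ (Ex m K (fun s => (eta_from k s (x, k%:Z + j%:Z))%:R) closed)).
  apply: (@Ex_le_cover _ _ _ (@leU R d r) (@leU_refl R d r) m K) => //.
  - exact: eta_from_ex_mono.
  - by move=> z U; exact: botU_le.
rewrite /K (@Ex_map _ _ _ m _ (fun z => z - (x, k%:Z))); last 2 first.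
- by move=> z; rewrite addrK.
- by move=> z; rewrite subrK.
rewrite le_eqVlt; apply/orP; left; apply/eqP; apply: eq_Ex => s.
rewrite (eta_from_shift k _ x j).
suff -> : field_shift (x, k%:Z) (s \o (fun z => z - (x, k%:Z))) = s by [].
by apply/funext => z; rewrite /field_shift /= addrK.
Qed.

(* The exploration of level k follows forward in time the process started from
   all ones just before time k, and reveals a site after time k only if the
   process is not zero on its neighbourhood; the sites before time k are
   revealed only if that process survives at the origin at time n. *)
Definition revealed n k (z : site d * int) s : bool :=
  if z.2 < k%:Z then eta_from k s (0, n%:Z) else live k s z.

(** Sites from level k on are ordered by time; those below the level come last, as [n.+1] exceeds
    every time up to n. *)
Definition revealment_rank n k (z : site d * int) : nat :=
  if z.2 < k%:Z then n.+1 else `|z.2|%N.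

Definition pivotality n z : R :=
  theta n - Ex m (origin_cone n)
    (fun s => (eta_from 0 (upd s z botU) (0, n%:Z))%:R) closed.

Lemma eta_from_upd_bot n z s :
  (eta_from 0 (upd s z botU) (0, n%:Z))%:R <= (eta_from 0 s (0, n%:Z))%:R :> R.
Proof.
apply: eta_from_ex_mono => y; rewrite /upd; case: eqP => // _.
  exact: botU_le.
exact: leU_refl.
Qed.

Lemma pivotality_ge0 n z : 0 <= pivotality n z.
Proof.
rewrite subr_ge0; apply: le_Ex => // s; exact: eta_from_upd_bot.
Qed.

(** OSSS with F and g both equal to the survival indicator, whose covariance with itself is its
    variance. *)
Lemma variance_le n k : theta n * (1 - theta n) <=
  \sum_(z <- origin_cone n)
    Ex m (origin_cone n) (fun s => (revealed n k z s)%:R) closed * pivotality n z.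
Proof.
pose g s : R := (eta_from 0 s (0, n%:Z))%:R.
have h := @osss R _ _ m botU (origin_cone n) closed m0 m1
  (revealment_rank n k) (revealed n k) g g.
apply: (le_trans _ (h _ _ _ _ _ (undup_uniq _))); last 5 first.
- by move=> s; rewrite /g ler0n lern1 leq_b1.
- by move=> s z; exact: eta_from_upd_bot.
- move=> z s s' ss; rewrite /revealed; case: ifPn => zk.
    apply: eq_eta_from => y ky /= yn; apply: ss.
    rewrite /revealment_rank zk ltNge ky /= ltnS.
    by move: ky yn; case: (y.2) => //= u _; rewrite lez_nat.
  apply: eq_live => y ky yz; apply: ss.
  rewrite /revealment_rank (negbTE zk) ltNge ky /=.
  by move: ky yz; case: (y.2) => //= u _; case: (z.2).
(* A site below level k is unrevealed only if the level-k process is zero at the origin at time n;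
   the dominated process from time 0 is then zero there too, whatever the family at that site. *)
- move=> z s U; rewrite /revealed /g; case: ifPn => zk.
    move=> nk; congr (_%:R); congr nat_of_bool; apply/idP/idP => /eta_from_level0 h0.
      by have := h0 k; rewrite eta_from_upd ?zk// (negbTE nk).
    by have := h0 k; rewrite (negbTE nk).
  move=> nl; rewrite eta_from_upd//; apply/orP; right.
  apply: contra nl => /liveP[y yh]; apply/liveP; exists y.
  exact: eta_from_level0.
- move=> z s U z' zk.
  have e y : eta_from k (upd s z U) y = eta_from k s y.
    apply: eta_from_upd; move: zk; rewrite /revealed; case: ifP => //= _.
  rewrite /revealed; case: ifP => _; first by rewrite e.
  by apply/liveP/liveP => -[y yh]; exists y; rewrite ?e// -?e.
rewrite mulrBr mulr1 lerD2r le_eqVlt; apply/orP; left; apply/eqP.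
by apply: eq_Ex => s; rewrite /g -natrM mulnb andbb.
Qed.

(** Here N will be the time depth of a neighbour; terms too recent to carry the delay get the
    trivial bound 1. *)
Lemma sum_delayed (u : nat -> R) (N t : nat) : (forall j, 0 <= u j) ->
  \sum_(i < t) (if (i < N)%N then 1 else u (i - N)%N) <=
  N%:R + \sum_(j < t) u j.
Proof.
move=> u0.
suff E : \sum_(i < t) (if (i < N)%N then 1 else u (i - N)%N) <=
    N%:R + \sum_(j < t - N) u j.
  apply: (le_trans E); rewrite lerD2l -!(big_mkord xpredT u).
  rewrite [leRHS](@big_cat_nat _ _ _ (t - N))//= ?leq_subr// lerDl.
  by apply: sumr_ge0.
suff -> : \sum_(i < t) (if (i < N)%N then 1 else u (i - N)%N) =
    (minn N t)%:R + \sum_(j < t - N) u j.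
  by rewrite lerD2r ler_nat geq_minl.
elim: t => [|t IH]; first by rewrite !big_ord0 minn0 addr0.
rewrite big_ord_recr/= IH; have [tN|] := boolP (t < N)%N.
  rewrite (minn_idPr tN) (minn_idPr (ltnW tN)) -natr1.
  have -> : (t.+1 - N = 0)%N by apply/eqP; rewrite subn_eq0.
  have -> : (t - N = 0)%N by apply/eqP; rewrite subn_eq0 ltnW.
  by rewrite !big_ord0 !addr0.
rewrite -leqNgt => tN; rewrite (minn_idPl tN) (minn_idPl (leqW tN)) subSn//.
by rewrite big_ord_recr/= addrA.
Qed.

(** The leading 1 pays for the levels above z; a neighbour y pays its time depth for trivially
    bounded levels and 1 for a sum of [theta]. *)
Definition revealment_const : R := 1 + \sum_(y : nbh d r) (`|(val y).2|%N.+1)%:R.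

(** For a level k above z, revealment is survival of the origin for n - k steps; otherwise a union
    bound over neighbours y of z leaves survival from level k to the time of [z + val y]. Summed
    over k, both are sums of [theta]. *)
Lemma revealment_sum n z : z \in origin_cone n ->
  \sum_(i < n) Ex m (origin_cone n) (fun s => (revealed n i.+1 z s)%:R) closed <=
  revealment_const * (1 + \sum_(j < n) theta j).
Proof.
rewrite mem_undup => /cone_time /= /andP[_ zn].
pose T := \sum_(j < n) theta j; rewrite -/T.
have T0 : 0 <= T by apply: sumr_ge0 => j _; exact: theta_ge0.
pose c k (y : nbh d r) : R := if z.2 < k%:Z then 0 else
  Ex m (origin_cone n) (fun s => (eta_from k s (z + val y))%:R) closed.
have step (i : 'I_n) :
    Ex m (origin_cone n) (fun s => (revealed n i.+1 z s)%:R) closed <=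
    \sum_(y : nbh d r) c i.+1 y + theta (n - i.+1).
  rewrite /revealed /c; case: ltP => zi.
    rewrite big1// add0r.
    have -> : n%:Z = i.+1%:Z + (n - i.+1)%N%:Z by rewrite -PoszD subnKC.
    exact: Ex_eta_from_le.
  rewrite -Ex_sum//; apply: ler_wpDr; first exact: theta_ge0.
  apply: le_Ex => // s; case: liveP => [[y yh]|_]; last exact: sumr_ge0.
  by rewrite (bigD1 y)//= yh lerDl; exact: sumr_ge0.
apply: (le_trans (ler_sum _ (fun i _ => step i))).
rewrite big_split/= exchange_big/=.
have -> : \sum_(i < n) theta (n - i.+1) = T.
  by rewrite [RHS](reindex_inj rev_ord_inj)/=.
rewrite /revealment_const mulrDl mul1r addrC lerD//.
  by rewrite lerDr.
rewrite mulr_suml; apply: ler_sum => y _; rewrite /c.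
case E: (z.2) => [t|t]; last first.
  by rewrite big1// mulr_ge0// addr_ge0.
rewrite E lez_nat in zn.
(* After reversal the index is the distance from the level to time t; if it is smaller than the
   depth of y, then [z + val y] lies before the level. *)
apply: (@le_trans _ _ (\sum_(i < t)
    (if (i < `|(val y).2|)%N then 1 else theta (i - `|(val y).2|)%N))); last first.
  apply: (le_trans (sum_delayed _ _ theta_ge0)).
  have tT : \sum_(j < t) theta j <= T.
    rewrite /T -!(big_mkord xpredT theta) [leRHS](@big_cat_nat _ _ _ t)//= lerDl.
    by apply: sumr_ge0 => j _; exact: theta_ge0.
  have N0 : 0 <= (`|(val y).2|%N)%:R :> R by [].
  rewrite -natr1; nra.
rewrite [leRHS](reindex_inj rev_ord_inj)/=.
rewrite (big_ord_widen_cond n (fun=> true) (fun i => if (t - i.+1 < `|(val y).2|)%N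
   then 1 else theta (t - i.+1 - `|(val y).2|)%N))//=.
rewrite [leRHS]big_mkcond/=; apply: ler_sum => i _.
rewrite ltz_nat ltnS; case: ltnP => it; last by [].
case: ifPn => h.
  by apply: Ex_le1 => // s; rewrite lern1 leq_b1.
rewrite -leqNgt in h.
have y0 := nbh_lt0 y.
have -> : z + val y = (z.1 + (val y).1, i.+1%:Z + (t - i.+1 - `|(val y).2|)%N%:Z).
  congr (_, _); rewrite /= E; move: ((val y).2) y0 h => u u0 h; lia.
exact: Ex_eta_from_le.
Qed.

Lemma theta_osss n : n%:R * (theta n * (1 - theta n)) <=
  revealment_const * (1 + \sum_(j < n) theta j) *
  \sum_(z <- origin_cone n) pivotality n z.
Proof.
have -> : n%:R * (theta n * (1 - theta n)) = \sum_(i < n) theta n * (1 - theta n).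
  by rewrite sumr_const card_ord mulr_natl.
apply: (le_trans (ler_sum _ (fun (i : 'I_n) _ => variance_le n i.+1))).
rewrite exchange_big/= mulr_sumr big_seq [leRHS]big_seq.
apply: ler_sum => z zc; rewrite -mulr_suml; apply: ler_wpM2r.
  exact: pivotality_ge0.
exact: revealment_sum.
Qed.

End SurvivalProbability.
Arguments origin_cone {R d} r n.
Arguments closed {R d r}.

(** * The differential inequality implies exponential decay *)

Section Gronwall.
Context (R : realType).

(** [expR (- c * x) * f x] is nondecreasing by the mean value theorem. The case c = 0 serves as the
    monotonicity criterion. *)
Lemma gronwall (f df : R -> R) (a b c : R) : a <= b ->
  {within `[a, b], continuous f} ->
  (forall x : R, a < x < b -> is_derive x (1 : R) f (df x)) ->
  (forall x : R, a < x < b -> c * f x <= df x) ->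
  f a <= expR (- c * (b - a)) * f b.
Proof.
move=> ab cf df1 hf; move: ab; rewrite le_eqVlt => /predU1P[<-|ab].
  by rewrite subrr mulr0 expR0 mul1r.
pose g x := expR (- c * x) * f x.
have dg x : a < x < b ->
    is_derive x (1 : R) g (expR (- c * x) * df x - c * expR (- c * x) * f x).
  move=> xab; have dfx := df1 x xab; rewrite /g; apply: is_derive_eq.
  by rewrite /GRing.scale/=; ring.
have cg : {within `[a, b], continuous g}.
  move=> x; apply: cvgM; last exact: cf.
  apply: continuous_subspaceT => y.
  apply: continuous_comp; last exact: continuous_expR.
  by apply: cvgM; [exact: cvg_cst|exact: cvg_id].
have [x xab gE] := @MVT R g _ a b ab (fun x h => dg x h) cg.
have gab : g a <= g b.
  rewrite -subr_ge0 gE; apply: mulr_ge0; last by rewrite subr_ge0 ltW.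
  have -> : expR (- c * x) * df x - c * expR (- c * x) * f x =
    expR (- c * x) * (df x - c * f x) by ring.
  by rewrite mulr_ge0 ?expR_ge0// subr_ge0; apply: hf.
have := ler_wpM2l (expR_ge0 (c * a)) gab.
rewrite /g mulrA -expRD mulNr addrN expR0 mul1r mulrA -expRD.
by congr (_ <= expR _ * _); ring.
Qed.

End Gronwall.

Section Sharpness.
Context (R : realType) (th dth : nat -> R -> R) (K : R).
Hypothesis K0 : 0 < K.
Hypothesis th01 : forall n (x : R), 0 < x <= 1 -> 0 <= th n x <= 1.
Hypothesis dthP : forall n (x : R), is_derive x (1 : R) (th n) (dth n x).
Hypothesis dth0 : forall n (x : R), 0 < x <= 1 -> 0 <= dth n x.
Hypothesis th_ineq : forall n (x : R), 0 < x <= 1 ->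
  n%:R * (th n x * (1 - th n x)) <= K * (1 + \sum_(j < n) th j x) * dth n x.
Hypothesis th1_cvg0 : th n 1 @[n --> \oo] --> (0 : R).

Let S n x := 1 + \sum_(j < n) th j x.

Let is_derive_continuous (f df : R -> R) (a b : R) :
  (forall x : R, is_derive x (1 : R) f (df x)) -> {within `[a, b], continuous f}.
Proof.
move=> fd; apply: continuous_subspaceT => x.
by apply: differentiable_continuous; apply/derivable1_diffP; case: (fd x).
Qed.

Let th_mono n x y : 0 < x -> x <= y -> y <= 1 -> th n x <= th n y.
Proof.
move=> x0 xy y1; have := @gronwall R (th n) (dth n) x y 0 xy.
rewrite oppr0 mul0r expR0 mul1r; apply.
- by apply: is_derive_continuous; exact: dthP.
- move=> z /andP[xz zy]; rewrite mul0r; apply: dth0.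
by rewrite (lt_trans x0)//= (le_trans (ltW zy)).
Qed.

Let S_ge1 n x : 0 < x <= 1 -> 1 <= S n x.
Proof.
by move=> x1; rewrite lerDl sumr_ge0// => j _; have /andP[] := th01 j x1.
Qed.

Let S_mono n x y : 0 < x -> x <= y -> y <= 1 -> S n x <= S n y.
Proof. by move=> *; rewrite lerD2l ler_sum// => j _; exact: th_mono. Qed.

Let S_le n x : 0 < x <= 1 -> S n x <= 1 + n%:R.
Proof.
move=> x1; rewrite lerD2l -[X in _ <= X%:R]card_ord -sum1_card natr_sum.
by apply: ler_sum => j _; have /andP[] := th01 j x1.
Qed.

Let S_recr n x : S n.+1 x = S n x + th n x.
Proof. by rewrite /S big_ord_recr/= addrA. Qed.

Let dth_lb n x : 0 < x <= 1 -> th n 1 <= 2^-1 ->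
  n%:R * th n x <= 2 * K * S n x * dth n x.
Proof.
move=> x01 h; have := th_ineq n x01; rewrite -/(S n x) => h2.
have xh : th n x <= 2^-1.
  by apply: le_trans h; case/andP: x01 => *; exact: th_mono.
have /andP[t0 _] := th01 n x01.
have nt : 0 <= n%:R * th n x by rewrite mulr_ge0.
have -> : 2 * K * S n x * dth n x = 2 * (K * S n x * dth n x) by ring.
apply: (@le_trans _ _ (2 * (n%:R * (th n x * (1 - th n x))))); last by lra.
have -> : 2 * (n%:R * (th n x * (1 - th n x))) = n%:R * th n x * (2 * (1 - th n x)).
  by ring.
by rewrite ler_peMr//; lra.
Qed.

(** Once [1 - th n] is at least 1/2 and [S n] at most B, the logarithmic derivative of [th n] is at
    least n / (2 K B), which Gronwall integrates from x to y. *)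
Let decay n x y B : 0 < x -> x <= y -> y <= 1 -> th n 1 <= 2^-1 ->
  S n y <= B -> th n x <= expR (- (n%:R / (2 * K * B)) * (y - x)).
Proof.
move=> x0 xy y1 h SB.
have y01 : 0 < y <= 1 by rewrite y1 (lt_le_trans x0).
have B0 : 0 < B by apply: lt_le_trans SB; apply: lt_le_trans (S_ge1 n y01).
have KB0 : 0 < 2 * K * B by rewrite !mulr_gt0.
have G := @gronwall R (th n) (dth n) x y (n%:R / (2 * K * B)) xy.
apply: (le_trans (G _ _ _)).
- by apply: is_derive_continuous; exact: dthP.
- move=> z /andP[xz zy].
  have z01 : 0 < z <= 1 by rewrite (lt_trans x0)//= (le_trans (ltW zy)).
  rewrite mulrAC ler_pdivrMr//; apply: (le_trans (dth_lb z01 h)).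
  rewrite [leRHS]mulrC; apply: ler_wpM2r; first exact: dth0.
  rewrite ler_pM2l ?mulr_gt0//; apply: le_trans SB.
  by case/andP: z01 => z0 _; exact: S_mono (ltW zy) _.
- by have /andP[_ t1] := th01 n y01; rewrite ler_piMr// expR_ge0.
Qed.

Let ln_incr (a b : R) : 0 < a -> a <= b -> (b - a) / b <= ln b - ln a.
Proof.
move=> a0 ab; have b0 : 0 < b by exact: lt_le_trans ab.
have ab0 : 0 < a / b by rewrite divr_gt0.
rewrite -[leRHS]opprB -ln_div ?posrE// lerNr.
have -> : a / b = 1 + (a / b - 1) by ring.
apply: (le_trans (le_ln1Dx _)); first by lra.
rewrite le_eqVlt; apply/orP; left; apply/eqP; field; lra.
Qed.

Let ln_incr_le (a b : R) : 0 < a -> a <= b -> ln b - ln a <= (b - a) / a.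
Proof.
move=> a0 ab; have b0 : 0 < b by exact: lt_le_trans ab.
have ab0 : 0 < b / a by rewrite divr_gt0.
rewrite -ln_div ?posrE//.
have -> : b / a = 1 + (b / a - 1) by ring.
apply: (le_trans (le_ln1Dx _)); first by lra.
rewrite le_eqVlt; apply/orP; left; apply/eqP; field; lra.
Qed.

Let harmonic_le n0 n : (0 < n0)%N -> (0 < n)%N ->
  \sum_(n0 <= i < n.+1) i%:R^-1 <= 1 + ln n%:R :> R.
Proof.
move=> n00; case: n => // n _; elim: n => [|n IH].
  rewrite ln1 addr0; case: n0 n00 => // -[|n0] _.
    by rewrite big_nat1 invr1.
  by rewrite big_geq.
have [n0n|nn0] := leqP n0 n.+2; last first.
  by rewrite big_geq// addr_ge0// ln_ge0// ler1n.
rewrite big_nat_recr//=; apply: (le_trans (lerD IH (lexx _))).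
rewrite -addrA lerD2l -lerBrDl.
apply: le_trans (ln_incr _ _); rewrite ?ler_nat//.
by rewrite -natrB// subSnn mul1r.
Qed.

Let inv_square_le n0 n : (0 < n0)%N ->
  \sum_(n0 <= i < n) (i%:R ^+ 2)^-1 <= 2 :> R.
Proof.
move=> n00; case: n => [|n]; first by rewrite big_geq.
(* Strengthened by the term 1/(n+1), which makes the induction telescope. *)
suff H : \sum_(n0 <= i < n.+2) (i%:R ^+ 2)^-1 <= 2 - n.+1%:R^-1 :> R.
  case: (leqP n0 n.+1) H => [n0n|n0n _]; last first.
    by rewrite big_geq// ltnW.
  rewrite big_nat_recr//= => H.
  apply: (@le_trans _ _ (2 - n.+1%:R^-1)); last by rewrite gerBl.
  by apply: le_trans H; rewrite lerDl invr_ge0 sqr_ge0.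
elim: n => [|n IH].
  rewrite invr1; case: n0 n00 => // -[|n0] _.
    by rewrite big_nat1 expr1n invr1; lra.
  by rewrite big_geq//; lra.
have n1 : 1 <= n.+1%:R :> R by rewrite ler1n.
have [n0n|nn0] := leqP n0 n.+2; last first.
  by rewrite big_geq// subr_ge0 (@le_trans _ _ 1)// ?invf_le1 ?ler1n// ; lra.
rewrite big_nat_recr//=; apply: (le_trans (lerD IH (lexx _))).
rewrite -[n.+2%:R]natr1; move: (n.+1%:R) n1 => u u1.
rewrite -subr_ge0.
have -> : 2 - (u + 1)^-1 - (2 - u^-1 + ((u + 1) ^+ 2)^-1) =
  (u * (u + 1) ^+ 2)^-1 by field; lra.
by rewrite invr_ge0 mulr_ge0// ?sqr_ge0//; lra.
Qed.

(* Integrate the inequality for the sum of th i / i between x and 1: its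
   right-hand side telescopes to a multiple of ln (S n), whereas the sum itself
   is o(ln n) at 1. *)
Let S_sqrt_bound x : 0 < x < 1 -> exists n0 : nat, (0 < n0)%N /\
  (forall n, (n0 <= n)%N -> th n 1 <= 2^-1) /\
  exists2 B : R, 0 < B &
    forall n, (n0 <= n)%N -> S n x <= B * Num.sqrt n%:R.
Proof.
move=> /andP[x0 x1].
have x01 : 0 < x <= 1 by rewrite x0 ltW.
(* The second bound makes the growth exponent 2 K eta / (1 - x) of [S n x] at most 1/2; the first
   gives [th n 1 <= 2^-1]. *)
pose eta := Num.min (2^-1) ((1 - x) / (4 * K)).
have eta0 : 0 < eta by rewrite lt_min invr_gt0 ltr0n divr_gt0 ?subr_gt0 ?mulr_gt0.
have [n1 _ hn1] : \forall n \near \oo, th n 1 <= eta.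
  near=> n; apply: ltW; near: n.
  have := th1_cvg0 => /cvgr_lt; apply; exact: eta0.
have [n0 [n00 th_eta]] : exists n0, (0 < n0)%N /\
    forall n, (n0 <= n)%N -> th n 1 <= eta.
  by exists n1.+1; split => // n n1n; apply: hn1; exact: ltnW.
exists n0; split => //; split.
  by move=> n /th_eta h; apply: (le_trans h); rewrite ge_min lexx.
(* [C] bounds [S n0], the lower end of the telescoping sum; the factor [expR (2^-1)] below comes
   from the 1 in [harmonic_le]. *)
pose C : R := 1 + n0%:R.
exists (C * expR (2^-1)).
  by rewrite mulr_gt0 ?expR_gt0// /C ltr_pwDl.
move=> n n0n; have n_gt0 : (0 < n)%N by exact: leq_trans n0n.
apply: (@le_trans _ _ (S n.+1 x)).
  by rewrite S_recr lerDl; have /andP[] := th01 n x01.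
pose T y := \sum_(n0 <= i < n.+1) i%:R^-1 * th i y.
pose dT y := \sum_(n0 <= i < n.+1) i%:R^-1 * dth i y.
have dTP (y : R) : is_derive y (1 : R) T (dT y).
  have -> : T = \sum_(n0 <= i < n.+1) (fun y => i%:R^-1 * th i y).
    by apply/funext => z; rewrite /T fct_sumE.
  rewrite /dT; elim/big_ind2 : _ => [|f1 d1 f2 d2 h1 h2|i _].
  - exact: is_derive_cst.
  - exact: is_deriveD.
  - have := @is_deriveZ _ _ _ (th i) (i%:R^-1) y (1 : R) _ (dthP i y).
    by [].
have [c] := @MVT R T dT x 1 x1 (fun y _ => dTP y)
  (@is_derive_continuous T dT x 1 dTP).
rewrite in_itv/= => /andP[xc c1] TE.
have c01 : 0 < c <= 1 by rewrite (lt_trans x0)//= ltW.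
have T1 : T 1 - T x <= eta * (1 + ln n%:R).
  apply: (@le_trans _ _ (T 1)).
    rewrite gerBl; apply: sumr_ge0 => i _; rewrite mulr_ge0//.
    by have /andP[] := th01 i x01.
  apply: (le_trans _ (ler_wpM2l (ltW eta0) (@harmonic_le n0 n _ _))) => //.
  rewrite /T mulr_sumr; apply: ler_sum_nat => i /andP[ni _].
  by rewrite mulrC ler_wpM2r// th_eta.
(* Each term dominates th i / (2 K S i), and th i / S i is at least the increment of ln (S i)
   because [th i] is the increment of [S i]. *)
have dTlb : (ln (S n.+1 c) - ln (S n0 c)) / (2 * K) <= dT c.
  rewrite -(@telescope_sumr _ n0 n.+1 (fun i => ln (S i c))); last by rewrite leqW.
  rewrite mulr_suml; apply: ler_sum_nat => i /andP[ni _].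
  have S1 := S_ge1 i c01; have S0 : 0 < S i c by lra.
  have /andP[t0 _] := th01 i c01.
  rewrite ler_pdivrMr ?mulr_gt0//.
  apply: (le_trans (ln_incr_le S0 _)); first by rewrite S_recr lerDl.
  rewrite S_recr addrAC subrr add0r ler_pdivrMr//.
  have i0 : 0 < i%:R :> R by rewrite ltr0n (leq_trans n00).
  have -> : i%:R^-1 * dth i c * (2 * K) * S i c = (2 * K * S i c * dth i c) / i%:R.
    by ring.
  rewrite ler_pdivlMr// mulrC; apply: dth_lb => //.
  by apply: (le_trans (th_eta _ ni)); rewrite ge_min lexx.
have Sx0 : 0 < S n.+1 x by have := S_ge1 n.+1 x01; lra.
have Sn0 : 0 < S n0 c by have := S_ge1 n0 c01; lra.
have C0 : 0 < C by rewrite /C ltr_pwDl.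
have lnC : ln (S n0 c) <= ln C.
  by rewrite ler_ln ?posrE//; exact: S_le.
have lnS : ln (S n.+1 x) <= ln (S n.+1 c).
  by rewrite ler_ln ?posrE ?(S_mono _ x0 (ltW xc) (ltW c1))// (lt_le_trans Sx0)//
    (S_mono _ x0 (ltW xc) (ltW c1)).
have lnn : 0 <= ln n%:R :> R by rewrite ln_ge0// ler1n.
have main : ln (S n.+1 x) - ln C <= 2^-1 * (1 + ln n%:R).
  have h1 : (ln (S n.+1 x) - ln C) / (2 * K) * (1 - x) <= eta * (1 + ln n%:R).
    apply: le_trans T1; rewrite TE; apply: ler_wpM2r; first by lra.
    apply: le_trans dTlb; rewrite ler_pM2r ?invr_gt0 ?mulr_gt0//; lra.
  have h2 : eta * (1 + ln n%:R) <= (1 - x) / (4 * K) * (1 + ln n%:R).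
    by rewrite ler_wpM2r ?ge_min ?lexx ?orbT//; lra.
  have := le_trans h1 h2; set l := ln (S n.+1 x) - ln C; set u := 1 + ln n%:R.
  have xK : 0 < (1 - x) / (2 * K) by rewrite divr_gt0 ?mulr_gt0// subr_gt0.
  have -> : l / (2 * K) * (1 - x) = (1 - x) / (2 * K) * l by ring.
  have -> : (1 - x) / (4 * K) * u = (1 - x) / (2 * K) * (2^-1 * u).
    by field; rewrite gt_eqF.
  by rewrite ler_pM2l.
have nR : 0 < n%:R :> R by rewrite ltr0n.
rewrite -ler_ln ?posrE ?mulr_gt0 ?expR_gt0 ?sqrtr_gt0//.
rewrite !lnM ?posrE ?mulr_gt0 ?expR_gt0 ?sqrtr_gt0// expRK.
have sq : ln n%:R = 2 * ln (Num.sqrt n%:R) :> R.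
  by rewrite -{1}(@sqr_sqrtr _ n%:R)// lnXn ?sqrtr_gt0// mulr2n; ring.
by move: main; rewrite sq; lra.
Unshelve. all: by end_near.
Qed.

(** Second integration, from x to the midpoint of x and 1: S = O(sqrt n) at the midpoint gives th n
    x <= exp (- c sqrt n), which is summable. *)
Let S_bounded x : 0 < x < 1 -> exists n0 : nat,
  (forall n, (n0 <= n)%N -> th n 1 <= 2^-1) /\
  exists2 B : R, 0 < B & forall n, S n x <= B.
Proof.
move=> /andP[x0 x1]; pose y := (x + 1) / 2.
have xy : x < y by rewrite /y; lra.
have y1 : y < 1 by rewrite /y; lra.
have y01 : 0 < y < 1 by rewrite y1 (lt_trans x0).
have x01 : 0 < x <= 1 by rewrite x0 ltW.
have [n0 [n00 [h2 [B B0 SB]]]] := S_sqrt_bound y01.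
exists n0; split => //.
pose c := (y - x) / (2 * K * B).
have c0 : 0 < c by rewrite divr_gt0 ?subr_gt0// !mulr_gt0.
(* From exp (- u) <= 1 / u at u = c sqrt n / 4, raised to the fourth power: a bound of order
   n^(-2). *)
pose D := (4 / c) ^+ 4.
have D0 : 0 < D by rewrite exprn_gt0// divr_gt0.
have thD n : (n0 <= n)%N -> th n x <= D * (n%:R ^+ 2)^-1.
  move=> n0n; have nR : 0 < n%:R :> R by rewrite ltr0n (leq_trans n00).
  have s0 : 0 < Num.sqrt n%:R :> R by rewrite sqrtr_gt0.
  have ss : n%:R = Num.sqrt n%:R ^+ 2 :> R by rewrite sqr_sqrtr// ltW.
  apply: (le_trans (decay x0 (ltW xy) (ltW y1) (h2 _ n0n) (SB _ n0n))).
  move: s0 ss; set s := Num.sqrt n%:R => s0 ->.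
  pose u := c * s / 4; have u0 : 0 < u by rewrite divr_gt0// mulr_gt0.
  have -> : - (s ^+ 2 / (2 * K * (B * s))) * (y - x) = - u + - u + (- u + - u).
    by rewrite /u /c; field; rewrite !gt_eqF.
  have eu : expR (- u) <= u^-1.
    rewrite expRN lef_pV2 ?posrE ?expR_gt0//.
    by have := expR_ge1Dx u; lra.
  have -> : D * ((s ^+ 2) ^+ 2)^-1 = (u^-1) ^+ 4.
    by rewrite /D /u; field; rewrite !gt_eqF.
  rewrite !expRD -!expr2 -exprM lerXn2r// nnegrE ?expR_ge0// invr_ge0 ltW//.
exists (1 + n0%:R + D * 2).
  by have : 0 <= n0%:R :> R by []; move: D0; lra.
move=> n; rewrite /S -addrA lerD2l.
rewrite -(big_mkord xpredT (fun j => th j x)).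
have [nn0|n0n] := leqP n n0.
  apply: ler_wpDr; first by rewrite mulr_ge0// ltW.
  apply: (@le_trans _ _ n%:R); last by rewrite ler_nat.
  rewrite big_mkord; have := S_le n x01; rewrite /S; lra.
rewrite (@big_cat_nat _ _ _ n0)//= ?(ltnW n0n)//; apply: lerD.
  by rewrite big_mkord; have := S_le n0 x01; rewrite /S; lra.
apply: (@le_trans _ _ (\sum_(n0 <= i < n) D * (i%:R ^+ 2)^-1)).
  by apply: ler_sum_nat => i /andP[ni _]; exact: thD.
by rewrite -mulr_sumr ler_pM2l// inv_square_le.
Qed.

Theorem sharp_decay x : 0 < x < 1 -> exists c C : R,
  [/\ 0 < c, 0 < C & forall n, th n x <= C * expR (- c * n%:R)].
Proof.
move=> /andP[x0 x1]; pose y := (x + 1) / 2.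
have xy : x < y by rewrite /y; lra.
have y1 : y < 1 by rewrite /y; lra.
have y01 : 0 < y < 1 by rewrite y1 (lt_trans x0).
have x01 : 0 < x <= 1 by rewrite x0 ltW.
have [n0 [h2 [B B0 SB]]] := S_bounded y01.
pose c := (y - x) / (2 * K * B).
have c0 : 0 < c by rewrite divr_gt0 ?subr_gt0// !mulr_gt0.
(* Third integration, now with S bounded; the constant makes the claim trivial for n < n0. *)
exists c, (expR (c * n0%:R)); split=> //; first exact: expR_gt0.
move=> n; rewrite -expRD; have [n0n|nn0] := leqP n0 n.
  apply: (le_trans (decay x0 (ltW xy) (ltW y1) (h2 _ n0n) (SB n))).
  rewrite ler_expR.
  have -> : - (n%:R / (2 * K * B)) * (y - x) = - c * n%:R by rewrite /c; ring.
  by rewrite lerDr mulr_ge0// ltW.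
have /andP[_ t1] := th01 n x01; apply: (le_trans t1).
rewrite -[leLHS]expR0 ler_expR mulNr -mulrBr.
by apply: mulr_ge0; [exact: ltW|rewrite subr_ge0 ler_nat ltnW].
Qed.

End Sharpness.

(** * Thinned laws and stochastic domination *)

Section ThinnedDecay.
Context (R : realType) (d : nat) (r : R).
Variable m : upfam d r -> R.
Hypotheses (m0 : forall U, 0 <= m U) (m1 : \sum_U m U = 1).

(** The sharpness argument runs in the thinning parameter; its endpoint 1 is the law m itself. *)
Lemma thinned_decay x : theta m n @[n --> \oo] --> (0 : R) -> 0 < x < 1 ->
  exists c C : R, [/\ 0 < c, 0 < C &
    forall n, theta (thin m botU x) n <= C * expR (- c * n%:R)].
Proof.
move=> cvg0 x01.
pose f n (s : site d * int -> upfam d r) : R := (eta_from 0 s (0, n%:Z))%:R.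
have t0 y : 0 < y <= 1 -> forall U, 0 <= thin m botU y U.
  by move=> /andP[y0 y1] U; rewrite thin_ge0// (ltW y0).
have t1 y := thin_sum1 botU y m1.
have rus n y : y * dEx m botU y (origin_cone r n) (f n) closed =
    \sum_(z <- origin_cone r n) pivotality (thin m botU y) n z.
  by rewrite russo// undup_uniq.
have K1 : 1 <= revealment_const d r by rewrite lerDl sumr_ge0.
apply: (@sharp_decay R (fun n y => theta (thin m botU y) n)
  (fun n y => dEx m botU y (origin_cone r n) (f n) closed)
  (revealment_const d r)) => //.
- exact: lt_le_trans K1.
- by move=> n y /t0 y0; rewrite theta_ge0// theta_le1.
- by move=> n y; exact: is_derive_Ex.
- move=> n y y01; have /andP[y0 _] := y01.
  rewrite -(pmulr_rge0 _ y0) rus; apply: sumr_ge0 => z _.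
  by apply: pivotality_ge0 => //; exact: t0.
- move=> n y y01; have /andP[y0 y1] := y01.
  apply: (le_trans (theta_osss (t0 _ y01) (t1 y) n)).
  have D0 : 0 <= dEx m botU y (origin_cone r n) (f n) closed.
    rewrite -(pmulr_rge0 _ y0) rus; apply: sumr_ge0 => z _.
    by apply: pivotality_ge0 => //; exact: t0.
  (* The pivotality sum is y times the derivative, hence at most the derivative as y <= 1. *)
  apply: ler_wpM2l; last by rewrite -rus ler_piMl.
  rewrite mulr_ge0 ?(le_trans ler01)// lerDl sumr_ge0// => j _.
  by apply: theta_ge0 => //; exact: t0.
- by rewrite thin1.
Qed.

End ThinnedDecay.

Section UpSets.
Context (R : realType) (A : finType) (le : rel A).
Implicit Types (m h : A -> R).

Definition up_set (E : {set A}) : Prop := forall a b, le a b -> a \in E -> b \in E.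

(* layer-cake decomposition of h into indicators of up-sets *)
Lemma upset_dominated m m' h (bot : A) :
  (forall E : {set A}, up_set E -> \sum_(a in E) m a <= \sum_(a in E) m' a) ->
  \sum_a m a = \sum_a m' a ->
  (forall a b, le a b -> h a <= h b) -> (forall a, le bot a) ->
  \sum_a m a * h a <= \sum_a m' a * h a.
Proof.
move=> mE mm hm lb.
(* Subtracting the minimum [h bot] is free because the total masses agree; the induction is on the
   size of the support. *)
suff H n (g : A -> R) : #|[pred a | 0 < g a]| = n -> (forall a, 0 <= g a) ->
    (forall a b, le a b -> g a <= g b) ->
    \sum_a m a * g a <= \sum_a m' a * g a.
  have hE (u : A -> R) :
      \sum_a u a * h a = \sum_a u a * (h a - h bot) + (\sum_a u a) * h bot.
    by rewrite mulr_suml -big_split/=; apply: eq_bigr => a _; ring.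
  rewrite !hE mm lerD2r; apply: H (erefl _) _ _ => [a|a b /hm ab].
    by rewrite subr_ge0 hm.
  by rewrite lerB.
elim/ltn_ind: n g => n IH g gn g0 gm.
have [/card0_eq g00|/card_gt0P[a0]] := posnP #|[pred a | 0 < g a]|.
  suff gE a : g a = 0 by rewrite !big1// => a _; rewrite gE mulr0.
  apply/eqP; have := g00 a; rewrite !inE lt_neqAle g0 andbT.
  by rewrite eq_sym => /negbFE.
rewrite inE => ga0.
have [b gb bmin] := @arg_minP _ R A a0 (fun a => 0 < g a) g ga0.
(* Peel off the lowest layer: the support of g is an up-set, and subtracting the least positive
   value there preserves monotonicity and shrinks the support. *)
pose g' a := if 0 < g a then g a - g b else 0.
have gE (u : A -> R) : \sum_a u a * g a =
    \sum_a u a * g' a + (\sum_(a in [set a | 0 < g a]%SET) u a) * g b.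
  rewrite mulr_suml [X in _ + X]big_mkcond/= -big_split/=; apply: eq_bigr => a _.
  rewrite /g' finset.inE; case: ltP => ga; first by ring.
  have -> : g a = 0 by apply/eqP; rewrite eq_le ga g0.
  by rewrite mulr0 addr0.
rewrite !gE; apply: lerD; last first.
  apply: ler_wpM2r => //; apply: mE => a c ac; rewrite !finset.inE => ga.
  exact: lt_le_trans (gm _ _ ac).
apply: (IH _ _ _ (erefl _)).
- rewrite -gn; apply: proper_card; apply/properP; split.
    by apply/fintype.subsetP => a; rewrite !inE /g'; case: ifP => //; rewrite ltxx.
  by exists b; rewrite inE ?gb// /g' gb subrr ltxx.
- by move=> a; rewrite /g'; case: ifPn => // /bmin; rewrite subr_ge0.
- move=> a c ac; rewrite /g'; case: ifPn => ga; case: ifPn => gc //.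
  + by rewrite lerB// gm.
  + by move: gc; rewrite (lt_le_trans ga (gm _ _ ac)).
  + by rewrite subr_ge0 bmin.
Qed.

End UpSets.

(** * Relative derivatives and integration of the strong increase *)

Section StrongIncrease.
Context (R : realType).

Lemma diff_quotE (f : R -> R) (p q : R) : f q = f p + diff_quot f p q * (q - p).
Proof.
rewrite /diff_quot; have [->|qp] := eqVneq q p; first by rewrite !subrr mulr0 addr0.
by rewrite divfK ?subr_eq0// addrC subrK.
Qed.

Lemma C1_on_continuous (p1 p2 : R) f : C1_on p1 p2 f ->
  {within `[p1, p2], continuous f}.
Proof.
move=> [df _]; apply/subspace_continuousP => x; rewrite /= in_itv/= => xp.
have fx : f y @[y --> within `[p1, p2] x^'] --> f x.
  have E : f = (fun y => f x + diff_quot f x y * (y - x)).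
    by apply/funext => y; exact: diff_quotE.
  rewrite {1}E [X in _ --> X](_ : _ = f x +
    lim (diff_quot f x @ within `[p1, p2] x^') * (x - x)); last first.
    by rewrite subrr mulr0 addr0.
  apply: cvgD; first exact: cvg_cst.
  apply: cvgM; first exact: df.
  apply: cvgB; last exact: cvg_cst.
  apply: cvg_within_filter; apply: cvg_within_filter; exact: cvg_id.
apply/cvgrPdist_lt => e e0; have /cvgrPdist_lt/(_ e e0) := fx.
rewrite /dnbhs !near_withinE; apply: filterS => y h yp.
by have [->|yx] := eqVneq y x; [rewrite subrr normr0|exact: h].
Qed.

Lemma near_dnbhs_shift (x : R) (P : set R) :
  (\forall y \near x^', P y) -> \forall h \near (0 : R)^', P (h + x).
Proof.
rewrite /dnbhs !near_withinE => H.
have : \forall y \near x, y != x -> P y by [].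
rewrite (near_shift 0 x); apply: filterS => h /=.
rewrite subr0 => hP h0; apply: hP; apply: contra h0 => /eqP.
by rewrite -[RHS]add0r => /addIr ->.
Qed.

Lemma C1_on_derive (p1 p2 : R) f x : C1_on p1 p2 f -> p1 < x < p2 ->
  is_derive x (1 : R) f (deriv_on p1 p2 f x).
Proof.
move=> [df _] /andP[p1x xp2].
have cv : diff_quot f x y @[y --> x^'] --> deriv_on p1 p2 f x.
  have /df xx : p1 <= x <= p2 by rewrite !ltW.
  apply/cvgrPdist_lt => e e0; have /cvgrPdist_lt/(_ e e0) := xx.
  rewrite near_withinE => h.
  have I : \forall y \near x^', y \in `[p1, p2].
    have xI : x \in `]p1, p2[ by rewrite in_itv/= p1x.
    apply: cvg_within; apply: filterS (near_in_itvoo xI) => y.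
    exact: subset_itv_oo_cc.
  by apply: filterS2 h I => y hy /hy.
have cv0 : h^-1 *: ((f \o shift x) (h *: (1 : R)) - f x) @[h --> (0 : R)^'] -->
    deriv_on p1 p2 f x.
  apply/cvgrPdist_lt => e e0; have /cvgrPdist_lt/(_ e e0)/near_dnbhs_shift := cv.
  apply: filterS => h /=; rewrite /diff_quot addrK /GRing.scale/= mulr1.
  by rewrite [_ / h]mulrC.
apply: DeriveDef; first by apply: cvgP cv0.
exact: (cvg_lim _ cv0).
Qed.

End StrongIncrease.

Section Domination.
Context (R : realType) (d : nat) (r p1 p2 : R) (ups : R -> pca d r).
Hypothesis ups_C1 : parametrised_model p1 p2 ups.

Lemma meas_is_derive (D : {set upfam d r}) x : p1 < x < p2 ->
  is_derive x (1 : R) (fun y : R => 1 - meas (ups y) D)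
    (- meas (pca_deriv p1 p2 ups x) D).
Proof.
move=> px.
have H : is_derive x (1 : R) (fun y : R => meas (ups y) D)
    (meas (pca_deriv p1 p2 ups x) D).
  have -> : (fun y : R => meas (ups y) D) = \sum_(U in D) (fun y : R => ups y U).
    by apply/funext => y; rewrite fct_sumE.
  rewrite /meas; elim/big_ind2 : _ => [|f1 d1 f2 d2 h1 h2|U _].
  - exact: is_derive_cst.
  - exact: is_deriveD.
  - exact: C1_on_derive.
have := is_deriveB (is_derive_cst (1 : R) x (1 : R)) H.
by rewrite sub0r.
Qed.

Lemma meas_continuous (D : {set upfam d r}) p q : p1 <= p -> q <= p2 ->
  {within `[p, q], continuous (fun y : R => 1 - meas (ups y) D)}.
Proof.
move=> p1p qp2; apply: (@continuous_subspaceW _ _ _ `[p1, p2]).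
  by apply: subset_itv; rewrite bnd_simp.
move=> x; apply: cvgB; first exact: cvg_cst.
have -> : (fun y : R => meas (ups y) D) = \sum_(U in D) (fun y : R => ups y U).
  by apply/funext => y; rewrite fct_sumE.
rewrite /meas; elim/big_ind2 : _ => [|f1 d1 f2 d2 h1 h2|U _].
- exact: cvg_cst.
- exact: cvgD.
- exact: (C1_on_continuous (ups_C1 U)).
Qed.

Lemma meas_setC (m : pca d r) (D : {set upfam d r}) :
  1 - meas m D = \sum_(U in ~: D) m U.
Proof.
rewrite -(mass_sum1 m) (bigID (mem D))/= /meas addrAC subrr add0r.
by apply: eq_bigl => U; rewrite finset.in_setC.
Qed.

(* Between p and q > p the family of laws gains at least an independent closure
   of every site with probability 1 - exp (- c0 (q - p)). *)
Lemma strongly_increasing_thin p q : strongly_increasing p1 p2 ups ->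
  p1 <= p -> p < q -> q <= p2 -> exists2 x : R, 0 < x < 1 &
    forall h : upfam d r -> R, (forall U V, leU U V -> h U <= h V) ->
      \sum_U ups p U * h U <= \sum_U thin (ups q) botU x U * h U.
Proof.
move=> [c0 c00 hD] p1p pq qp2; exists (expR (- c0 * (q - p))).
  by rewrite expR_gt0 -[ltRHS]expR0 ltr_expR mulNr oppr_lt0 mulr_gt0// subr_gt0.
move=> h hm; apply: (@upset_dominated _ _ (@leU R d r) _ _ _ botU) => //; last 2 first.
- by rewrite thin_sum1// !mass_sum1.
- by move=> U; exact: botU_le.
move=> E upE; have [botE|botE] := boolP (botU \in E).
  have ET : E = [set: upfam d r]%SET.
    apply/finset.setP => U; rewrite finset.inE; apply: upE botE; exact: botU_le.
  have sT (u : upfam d r -> R) : \sum_(U in [set: upfam d r]%SET) u U = \sum_U u U.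
    by apply: eq_bigl => U; rewrite finset.inE.
  by rewrite ET !sT thin_sum1 ?mass_sum1.
(* As [botU] is not in E, thinning only rescales the mass of E. *)
have thinE x : \sum_(U in E) thin (ups q) botU x U = x * \sum_(U in E) ups q U.
  rewrite mulr_sumr; apply: eq_bigr => U UE; rewrite /thin.
  by case: eqP UE botE => [-> ->//|_ _ _]; rewrite mulr0 addr0.
rewrite thinE.
have [->|E0] := eqVneq E finset.set0; first by rewrite !big_set0 mulr0.
(* The complement of E is a proper nonempty down-set, so strong increase says that the mass of E
   grows at logarithmic rate at least c0. *)
have dD : down_set (~: E)%SET.
  by move=> U V; rewrite !finset.in_setC => + VU; apply: contra; exact: upE.
have H := hD _ dD _ _.
rewrite -[E]finset.setCK -!meas_setC.
apply: (@gronwall _ (fun y => 1 - meas (ups y) (~: E)%SET)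
  (fun x => - meas (pca_deriv p1 p2 ups x) (~: E)%SET)) => //.
- exact: ltW.
- exact: meas_continuous.
- move=> x /andP[px xq]; apply: meas_is_derive.
  by rewrite (le_lt_trans p1p)//= (lt_le_trans xq).
move=> x /andP[px xq]; rewrite lerNr -mulNr; apply: H.
- by apply/finset.set0Pn; exists botU; rewrite finset.in_setC.
- apply: contra E0 => /eqP ET.
  by rewrite -[E]finset.setCK ET finset.setCT.
- by rewrite (le_trans p1p (ltW px)) (le_trans (ltW xq)).
Qed.

End Domination.

(** * Independent fields on a probability space *)

Section FieldProbability.
Context (R : realType) (dT : measure_display) (T : measurableType dT).
Variable P : probability T R.

Lemma measurable_cut (A : finType) (X : T -> A) (S : set T) :
  (forall a, measurable (S `&` [set w | X w = a])) -> measurable S.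
Proof.
move=> mS; have -> : S = \bigcup_(a in [set: A]) (S `&` [set w | X w = a]).
  apply/seteqP; split => [w Sw|w [a _ []]//].
  by exists (X w).
by apply: fin_bigcup_measurable => //; exact: finite_finset.
Qed.

Lemma prob_cut (A : finType) (X : T -> A) (S : set T) :
  (forall a, measurable (S `&` [set w | X w = a])) ->
  P S = (\sum_a P (S `&` [set w | X w = a]))%E.
Proof.
move=> mS.
have {1}-> : S = \bigcup_(a in [set` index_enum A]) (S `&` [set w | X w = a]).
  apply/seteqP; split => [w Sw|w [a _ []]//].
  by exists (X w) => //=; rewrite mem_index_enum.
rewrite measure_fin_bigcup//.
- by rewrite -fsbig_seq// index_enum_uniq.
- by move=> a b _ _ [w [[_ /= <-] [_ /= <-]]].
Qed.

Context (d : nat) (r : R) (ups : pca d r) (F : T -> site d * int -> upfam d r).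
Hypothesis iidF : iid_field ups P F.
Implicit Types (s : site d * int -> upfam d r) (L : seq (site d * int)).

Definition agree L s : set T := [set w | forall z, z \in L -> F w z = s z].

Lemma field_measurable z (B : {set upfam d r}) : measurable [set w | F w z \in B].
Proof. by case: iidF => h _ _; apply: h; exists z, B. Qed.

Lemma field_eq_measurable z U : measurable [set w | F w z = U].
Proof.
have -> : [set w | F w z = U] = [set w | F w z \in [set U]%SET].
  by apply/seteqP; split => w /=; rewrite finset.in_set1 => /eqP.
exact: field_measurable.
Qed.

Lemma agreeE L s : agree L s = \bigcap_(z in [set` [fset z in L]%fset])
  [set w | F w z \in [set s z]%SET].
Proof.
apply/seteqP; split => w /= h z; last first.
  by move=> zL; apply/eqP; rewrite -finset.in_set1; apply: h; rewrite /= in_fset.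
by rewrite /= in_fset finset.in_set1 => /h /eqP.
Qed.

Lemma agree_measurable L s : measurable (agree L s).
Proof.
rewrite agreeE; apply: fin_bigcap_measurable; first exact: finite_fset.
by move=> z _; exact: field_measurable.
Qed.

Lemma agree_prob L s : uniq L -> P (agree L s) = (\prod_(z <- L) ups (s z))%:E.
Proof.
case: iidF => _ marg indep uL; rewrite agreeE (indep _ (fun z => [set s z]%SET)).
rewrite (perm_big L)/=; last first.
  by apply: uniq_perm => [||z]; [exact: fset_uniq|exact: uL|rewrite in_fset].
rewrite -prodEFin; apply: eq_bigr => z _; rewrite marg /meas.
by rewrite finset.big_set1.
Qed.

(* Fubini: the event Phi may depend on the field both through its argument and
   directly, as long as frozen versions Phi s are independent of the field on L. *)
Lemma field_fubini L (Phi : (site d * int -> upfam d r) -> set T) s0 :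
  uniq L -> depends_on L Phi -> (forall s, measurable (Phi s)) ->
  (forall s, P (Phi s `&` agree L s) =
    (fine (P (Phi s)) * \prod_(z <- L) ups (s z))%:E) ->
  measurable [set w | Phi (F w) w] /\
  P [set w | Phi (F w) w] = (Ex ups L (fun s => fine (P (Phi s))) s0)%:E.
Proof.
move=> uL dPhi mPhi ind.
(* The field is already prescribed on J and still averaged on l; each step partitions by the value
   at the next site. *)
suff H l J s : J ++ l = L ->
    measurable ([set w | Phi (F w) w] `&` agree J s) /\
    P ([set w | Phi (F w) w] `&` agree J s) =
      (\prod_(z <- J) ups (s z) * Ex ups l (fun s => fine (P (Phi s))) s)%:E.
  have := H L [::] s0 erefl.
  have -> : agree [::] s0 = setT by apply/seteqP; split => // w _ z; rewrite in_nil.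
  by rewrite setIT big_nil mul1r.
elim: l J s => [|z l IH] J s JL.
  rewrite cats0 in JL; rewrite JL.
  have -> : [set w | Phi (F w) w] `&` agree L s = Phi s `&` agree L s.
    by apply/seteqP; split => w [/= h1 h2]; split => //;
      rewrite -?(dPhi _ _ h2)// (dPhi _ _ h2).
  split; first by apply: measurableI => //; exact: agree_measurable.
  by rewrite ind /= mulrC.
have zJ : z \notin J.
  by move: uL; rewrite -JL cat_uniq /= negb_or => /and3P[_ /andP[]].
have cutE U : ([set w | Phi (F w) w] `&` agree J s) `&` [set w | F w z = U] =
    [set w | Phi (F w) w] `&` agree (rcons J z) (upd s z U).
  apply/seteqP; split => w /=.
    move=> [[h1 h2] h3]; split => // y; rewrite mem_rcons inE => /predU1P[->|yJ].
      by rewrite upd_same.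
    by rewrite upd_other ?h2//; apply: contraNneq zJ => <-.
  move=> [h1 h2]; split; last by rewrite h2 ?upd_same// mem_rcons mem_head.
  split=> // y yJ; rewrite h2 ?mem_rcons ?inE ?yJ ?orbT// upd_other//.
  by apply: contraNneq zJ => <-.
have IHU U := IH (rcons J z) (upd s z U); rewrite cat_rcons in IHU.
have mcut U : measurable
    (([set w | Phi (F w) w] `&` agree J s) `&` [set w | F w z = U]).
  by rewrite cutE; case: (IHU U JL).
split; first exact: measurable_cut mcut.
rewrite (prob_cut mcut) /= mulr_sumr -sumEFin; apply: eq_bigr => U _.
rewrite cutE; case: (IHU U JL) => _ ->; congr (_%:E).
rewrite big_rcons/= upd_same mulrAC mulrA [in RHS]mulrAC; congr (_ * _ * _).
by apply: eq_big_seq => y yJ; rewrite upd_other//; apply: contraNneq zJ => <-.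
Qed.

Lemma field_event_indep L J (psi : (site d * int -> upfam d r) -> bool) s0 :
  uniq (J ++ L) -> depends_on J psi ->
  measurable [set w | psi (F w)] /\
  (P [set w | psi (F w)] = (Ex ups J (fun s => (psi s)%:R) s0)%:E /\
   P ([set w | psi (F w)] `&` agree L s0) =
    (fine (P [set w | psi (F w)]) * \prod_(z <- L) ups (s0 z))%:E).
Proof.
rewrite cat_uniq => /and3P[uJ JL uL] dpsi.
have psiT s : [set w : T | psi s] = if psi s then setT else set0.
  by case: (psi s); apply/seteqP; split.
have [m1 e1] : measurable [set w | psi (F w)] /\
    P [set w | psi (F w)] = (Ex ups J (fun s => (psi s)%:R) s0)%:E.
  have [|||m1 e1] := @field_fubini J (fun s => [set w | psi s]) s0 uJ.
  - by move=> s s' ss; apply/seteqP; split => w /=; rewrite (dpsi _ _ ss).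
  - by move=> s; rewrite psiT; case: ifP.
  - move=> s; rewrite psiT; case: ifP => _.
      by rewrite setTI agree_prob// probability_setT mul1r.
    by rewrite set0I measure0 mul0r.
  split => //; rewrite e1; congr (_%:E); apply: eq_Ex => s.
  by rewrite psiT; case: ifP => _; rewrite ?probability_setT ?measure0.
split => //; split => //.
have [|||m2 e2] := @field_fubini J (fun s => [set w | psi s] `&` agree L s0) s0 uJ.
- move=> s s' ss; apply/seteqP; split => w /= [h1 h2]; split => //;
    by rewrite ?(dpsi _ _ ss)// -(dpsi _ _ ss).
- move=> s; apply: measurableI; last exact: agree_measurable.
  by rewrite psiT; case: ifP.
- move=> s; rewrite psiT; case: ifP => _; last by rewrite !set0I measure0 mul0r.
  rewrite !setTI agree_prob//=.
  pose t z := if z \in J then s z else s0 z.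
  have -> : agree L s0 `&` agree J s = agree (J ++ L) t.
    apply/seteqP; split => w /=.
      move=> [h1 h2] z; rewrite mem_cat /t; case: ifP => [/h2//|_ /=]; exact: h1.
    move=> h; split => z zI; rewrite h ?mem_cat ?zI ?orbT// /t ?zI//.
    by rewrite (negbTE (hasPn JL _ zI)).
  rewrite agree_prob; last by rewrite cat_uniq uJ JL.
  rewrite big_cat/= mulrC; congr (_%:E); congr (_ * _).
    apply: eq_big_seq => z zL; by rewrite /t (negbTE (hasPn JL _ zL)).
  by apply: eq_big_seq => z zJ; rewrite /t zJ.
rewrite (_ : _ `&` _ = [set w | psi (F w) /\ agree L s0 w])// e2 e1/=.
congr (_%:E); rewrite mulrC -ExZ; apply: eq_Ex => s.
rewrite psiT; case: ifP => _; last by rewrite set0I measure0 mulr0.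
by rewrite setTI agree_prob// mulr1.
Qed.

End FieldProbability.

(** * The invariant measure obtained from all ones *)

Lemma cvg_Ex (R : realType) (I : eqType) (A : finType) (m : A -> R) (l : seq I)
    (f : nat -> (I -> A) -> R) (g : (I -> A) -> R) s :
  (forall s, f n s @[n --> \oo] --> g s) ->
  Ex m l (f n) s @[n --> \oo] --> Ex m l g s.
Proof.
move=> fg; elim: l s => //= z l IH s.
have -> : (fun n => \sum_a m a * Ex m l (f n) (upd s z a)) =
    \sum_a (fun n => m a * Ex m l (f n) (upd s z a)).
  by apply/funext => n; rewrite fct_sumE.
elim/big_ind2 : _ => [|f1 d1 f2 d2 h1 h2|a _].
- exact: cvg_cst.
- exact: cvgD.
- by apply: cvgM; [exact: cvg_cst|exact: IH].
Qed.

Section ProcessLimits.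
Context (R : realType) (d : nat) (r : R).
Implicit Types (F s : site d * int -> upfam d r).

(** Each coordinate of a decreasing sequence is eventually constant, and the process at one site
    reads finitely many coordinates. *)
Lemma pca_eta_limit (w : nat -> config d r) F :
  (forall n z, w n.+1 z -> w n z) ->
  forall (u : int) x, (forall n, pca_eta (w n) F x u) ->
    pca_eta (fun z => `[< forall n, w n z >]) F x u.
Proof.
move=> wS; have wanti n k z : (n <= k)%N -> w k z -> w n z.
  elim: k => [|k IH]; first by rewrite leqn0 => /eqP->.
  by rewrite leq_eqVlt => /predU1P[->//|nk] /wS; exact: IH.
pose wl z : bool := `[< forall n, w n z >].
suff H u x : exists N, forall n, (N <= n)%N -> pca_eta (w n) F x u = pca_eta wl F x u.
  by move=> u x wu; have [N HN] := H u x; rewrite -(HN N).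
move: u x; elim/time_ind => [u u0 x|t IH x].
  have [v|vp] := boolP (u \in past r); last first.
    exists 0%N => n _; rewrite !pca_eta_neg//.
    by case: insubP => // b; rewrite (negbTE vp).
  pose b : past r := [` v]%fset.
  have E (w' : config d r) : pca_eta w' F x u = w' (x, b).
    by rewrite -(pca_eta_past w' F x b).
  have [h|/existsNP[N hN]] := pselect (forall n, w n (x, b)).
    by exists 0%N => n _; rewrite !E h; apply/esym/asboolP.
  exists N => n Nn; rewrite !E.
  have -> : wl (x, b) = false by apply/asboolP => h; exact: hN.
  by apply/negP => /(wanti _ _ _ Nn).
have /choice[N HN] : forall y : nbh d r, exists N, forall n, (N <= n)%N ->
    pca_eta (w n) F (x + (val y).1) (t%:Z + (val y).2) =
    pca_eta wl F (x + (val y).1) (t%:Z + (val y).2).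
  by move=> y; apply: IH; exact: nbh_time.
exists (\max_(y : nbh d r) N y) => n nN; rewrite !pca_eta_nextE; apply: eq_in_val => //.
apply/finset.setP => y; rewrite !finset.inE; apply: HN.
by apply: leq_trans nN; exact: leq_bigmax.
Qed.

Lemma pca_eta_measurable (dT : measure_display) (T : measurableType dT)
    (w : T -> config d r) (F : T -> site d * int -> upfam d r) :
  (forall z, measurable [set a | w a z]) ->
  (forall z U, measurable [set a | F a z = U]) ->
  forall u x, measurable [set a | pca_eta (w a) (F a) x u].
Proof.
move=> mw mF; elim/time_ind => [u u0 x|t IH x].
  have [v|vp] := boolP (u \in past r).
    have -> // : [set a | pca_eta (w a) (F a) x u] = [set a | w a (x, [` v]%fset)].
    by apply/seteqP; split => a /=; rewrite -(pca_eta_past (w a) (F a)).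
  have -> // : [set a | pca_eta (w a) (F a) x u] = set0.
  apply/seteqP; split => a //=; rewrite pca_eta_neg//.
  by case: insubP => // b; rewrite (negbTE vp).
apply: (@measurable_cut _ _ _ (fun a => F a (x, t%:Z))) => U.
apply: (@measurable_cut _ _ _ (fun a => nbh_on (w a) (F a) (x, t%:Z))) => X.
have mX : measurable [set a | nbh_on (w a) (F a) (x, t%:Z) = X].
  have -> : [set a | nbh_on (w a) (F a) (x, t%:Z) = X] =
    \bigcap_(y in [set: nbh d r])
      [set a | pca_eta (w a) (F a) (x + (val y).1) (t%:Z + (val y).2) = (y \in X)].
    apply/seteqP; split => a /=.
      by move=> <- y _; rewrite /= !finset.inE.
    by move=> h; apply/finset.setP => y; rewrite !finset.inE; exact: h.
  apply: fin_bigcap_measurable => [|y _]; first exact: finite_finset.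
  have mIH := IH _ (nbh_time y t) (x + (val y).1).
  case: (y \in X); first exact: mIH.
  suff -> : [set a | pca_eta (w a) (F a) (x + (val y).1) (t%:Z + (val y).2) = false] =
     ~` [set a | pca_eta (w a) (F a) (x + (val y).1) (t%:Z + (val y).2)].
    exact: measurableC.
  by apply/seteqP; split => a /=; [move=> ->|move/negP/negbTE].
have [XU|XU] := boolP (X \in val U).
  have -> : [set a | pca_eta (w a) (F a) x t] `&` [set a | F a (x, t%:Z) = U]
      `&` [set a | nbh_on (w a) (F a) (x, t%:Z) = X] =
      [set a | F a (x, t%:Z) = U] `&` [set a | nbh_on (w a) (F a) (x, t%:Z) = X].
    apply/seteqP; split => a /= [] => [[_ ?] ?//|Fa Xa].
    by rewrite pca_eta_nextE Fa Xa.
  exact: measurableI.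
have -> // : [set a | pca_eta (w a) (F a) x t] `&` [set a | F a (x, t%:Z) = U]
    `&` [set a | nbh_on (w a) (F a) (x, t%:Z) = X] = set0.
apply/seteqP; split => a //= [[]] + Fa Xa.
by rewrite pca_eta_nextE Fa Xa (negbTE XU).
Qed.

Definition glue (n : nat) F s : site d * int -> upfam d r :=
  fun z => if z.2 < n%:Z then F z else s (z - (0, n%:Z)).

Lemma pca_eta_glue (n : nat) F s u x : (0 <= u) || (u \in past r) ->
  pca_eta (window (config1 d r) F n) s x u =
  pca_eta (config1 d r) (glue n F s) x (n%:Z + u).
Proof.
move=> u0; rewrite [RHS]pca_eta_window//.
have -> : window (config1 d r) (glue n F s) n = window (config1 d r) F n.
  apply/funext => -[y v]; rewrite /window.
  apply: (@eq_pca_eta _ _ _ _ _ _ (n%:Z + val v)) => // z _ zn.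
  by rewrite /glue (le_lt_trans zn)//; exact: past_time.
apply: (@eq_pca_eta _ _ _ _ _ _ u) => // z z0 _.
by rewrite /field_shift /glue /= gtrDr ltNge z0 /= addrK.
Qed.

(** State just before time 0 of the process started from all ones at time -n; the shift moves time
    -n to 0. *)
Definition omega_from F (n : nat) : config d r :=
  window (config1 d r) (field_shift (0, - n%:Z) F) n.

(** Started one step earlier, the process at time -n is at most all ones; then monotonicity
    applies. *)
Lemma omega_fromS F n z : omega_from F n.+1 z -> omega_from F n z.
Proof.
case: z => x v; rewrite /omega_from /window /=.
have -> : n.+1%:Z + val v = 1%:Z + (n%:Z + val v) by rewrite addrA -PoszD.
rewrite pca_eta_window; last exact: past_or_nonneg.
apply: pca_eta_mono => // y.
have -> : field_shift (0, 1%:Z) (field_shift (0, - n.+1%:Z) F) y =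
    field_shift (0, - n%:Z) F y; last exact: leU_refl.
rewrite /field_shift -addrA; congr (F (_ + (_, _))); rewrite /= ?addr0//.
by rewrite -addn1 PoszD; lia.
Qed.

Definition omega_limit F : config d r := fun z => `[< forall n, omega_from F n z >].

End ProcessLimits.

Section CylinderEvents.
Context (R : realType) (d : nat) (r : R).
Implicit Types (w : config d r) (F s : site d * int -> upfam d r).
Implicit Types (A : seq (site d * past r)) (n t : nat).

Definition occupied w A : bool := all w A.

Definition window_cones A t : seq (site d * int) :=
  flatten [seq cone r t (z.1, t%:Z + val z.2) | z <- A].

Lemma occupied_window_dep w A t :
  depends_on (window_cones A t) (fun F => occupied (window w F t) A).
Proof.
move=> F F' FF; apply: eq_in_all => -[x v] zA; rewrite /window.
apply: (@pca_eta_cone _ _ _ w t (x, t%:Z + val v)); first exact: past_time.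
by move=> z zc; apply: FF; apply/flatten_mapP; exists (x, v).
Qed.

(** The translated sites lie at negative times, whence independence from the field at nonnegative
    times. *)
Lemma occupied_from_dep A n t s :
  depends_on [seq z + (0, - n%:Z) | z <- [seq z <- flatten
      [seq cone r (n + t) (z.1, n%:Z + (t%:Z + val z.2)) | z <- A] | z.2 < n%:Z]]
    (fun F => occupied (window (omega_from F n) s t) A).
Proof.
move=> F F' FF; apply: eq_in_all => -[x v] zA; rewrite /window /=.
rewrite !pca_eta_glue ?past_or_nonneg//.
apply: (@pca_eta_cone _ _ _ _ (n + t) (x, n%:Z + (t%:Z + val v))).
  by rewrite /= PoszD ltrD2l; exact: past_time.
move=> z zc; rewrite /glue; case: ifP => // zn; apply: FF.
apply/mapP; exists z => //; rewrite mem_filter zn; apply/flatten_mapP.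
by exists (x, v).
Qed.

Lemma window0 w F : window w F 0 = w.
Proof. by apply/funext => -[x v]; rewrite /window add0r; exact: pca_eta_past. Qed.

Lemma occupied_measurable (dT : measure_display) (T : measurableType dT)
    (w : T -> config d r) A :
  (forall z, measurable [set a | w a z]) -> measurable [set a | occupied (w a) A].
Proof.
move=> mw; elim: A => [|z A IH] /=.
  have -> // : [set a : T | true] = setT by apply/seteqP; split.
have -> : [set a | w a z && all (w a) A] = [set a | w a z] `&` [set a | all (w a) A].
  by apply/seteqP; split => a /= /andP.
exact: measurableI.
Qed.

Lemma window_measurable (dT : measure_display) (T : measurableType dT)
    (w : T -> config d r) (F : T -> site d * int -> upfam d r) t :
  (forall z, measurable [set a | w a z]) ->
  (forall z U, measurable [set a | F a z = U]) ->
  forall z, measurable [set a | window (w a) (F a) t z].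
Proof. by move=> mw mF z; exact: pca_eta_measurable. Qed.

Lemma const_field_measurable (dT : measure_display) (T : measurableType dT) s z U :
  measurable [set a : T | s z = U].
Proof.
have [sU|sU] := pselect (s z = U).
  by rewrite (_ : [set _ | _] = setT)//; apply/seteqP; split.
by rewrite (_ : [set _ | _] = set0)//; apply/seteqP; split.
Qed.

Lemma Omega_coordinate_measurable (z : site d * past r) :
  measurable [set w : Omega d r | w z].
Proof. by apply: sub_sigma_algebra; exists z. Qed.

(** A generating family stable under intersection, hence determining probability measures. *)
Definition occupied_sets : set (set (config d r)) :=
  [set E | exists A, E = [set w | occupied w A]].

Lemma occupied_sets_generate :
  @measurable _ (Omega d r) = <<s occupied_sets >>.
Proof.
apply/seteqP; split.
  apply: smallest_sub; first exact: smallest_sigma_algebra.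
  move=> _ [z ->]; apply: sub_sigma_algebra; exists [:: z].
  by apply/seteqP; split => w /=; rewrite andbT.
apply: smallest_sub; first exact: (@smallest_sigma_algebra _ setT).
move=> _ [A ->]; apply: (@occupied_measurable _ (Omega d r) (fun w => w)).
exact: Omega_coordinate_measurable.
Qed.

Lemma measurable_to_Omega (dT : measure_display) (T : measurableType dT)
    (w : T -> Omega d r) :
  (forall z, measurable [set a | w a z]) -> measurable_fun setT w.
Proof.
move=> mw; apply: (@measurability _ _ T (Omega d r) setT w (@cylinders R d r)) => //.
by move=> _ [_ [z ->] <-]; rewrite setTI; exact: mw.
Qed.

Lemma Omega_measure_unique (mu nu : probability (Omega d r) R) :
  (forall A, mu [set w | occupied w A] = nu [set w | occupied w A]) ->
  forall E, measurable E -> mu E = nu E.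
Proof.
move=> mn E mE.
have U := @measure_unique _ R (Omega d r) occupied_sets (fun=> setT)
  occupied_sets_generate.
apply: (U _ _ _ mu nu) => //.
- move=> _ _ [A ->] [B ->]; exists (A ++ B).
  by apply/seteqP; split => w /=; rewrite /occupied all_cat => /andP.
- by move=> _; exists [::]; apply/seteqP; split.
- by rewrite bigcup_const.
- by move=> _ [A ->]; exact: mn.
- move=> _; exact: (le_lt_trans (probability_le1 mu measurableT) (ltry _)).
Qed.

End CylinderEvents.

Section Stationarity.
Context (R : realType) (d : nat) (r : R) (ups : pca d r).
Context (dT : measure_display) (T : measurableType dT) (P : probability T R).
Variable F : T -> site d * int -> upfam d r.
Hypothesis iidF : iid_field ups P F.

Lemma iid_field_shift v : iid_field ups P (fun a => field_shift v (F a)).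
Proof.
case: iidF => mF marg ind; split.
- by move=> _ [z [B ->]]; apply: mF; exists (z + v), B.
- by move=> z B; exact: marg.
move=> J B; pose J' : {fset site d * int} := [fset (z + v)%R | z in J]%fset.
pose B' z := B (z - v).
have -> : \bigcap_(z in [set` J]) [set a | field_shift v (F a) z \in B z] =
    \bigcap_(z in [set` J']) [set a | F a z \in B' z].
  apply/seteqP; split => a h z /=.
    move=> /imfsetP[y yJ ->] /=; rewrite /B' addrK; exact: h.
  move=> zJ; rewrite /field_shift -[z in B z](addrK v z); apply: h.
  by rewrite /=; apply/imfsetP; exists z.
rewrite ind (perm_big [seq z + v | z <- J])/=; last first.
  apply: uniq_perm; first exact: fset_uniq.
    by rewrite map_inj_uniq ?fset_uniq//; exact: addIr.
  move=> z; apply/imfsetP/mapP => -[y yJ ->]; by exists y.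
by rewrite big_map; apply: eq_bigr => z _; rewrite /B' addrK.
Qed.

End Stationarity.

(** * Stationarity of the limit from the distant past *)

Section LimitMeasure.
Context (R : realType) (d : nat) (r : R) (ups : pca d r).
Context (dT : measure_display) (T : measurableType dT) (P : probability T R).
Variable F : T -> site d * int -> upfam d r.
Hypothesis iidF : iid_field ups P F.
Implicit Types (s : site d * int -> upfam d r) (A : seq (site d * past r)).

Let s0 : site d * int -> upfam d r := closed.

Lemma field_law (dT' : measure_display) (T' : measurableType dT')
    (P' : probability T' R) (F' : T' -> site d * int -> upfam d r)
    J (psi : (site d * int -> upfam d r) -> bool) :
  iid_field ups P' F' -> depends_on J psi ->
  P [set a | psi (F a)] = P' [set a | psi (F' a)].
Proof.
move=> iidF' dpsi.
have dJ : depends_on (undup J) psi.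
  by move=> s s' ss; apply: dpsi => z zJ; apply: ss; rewrite mem_undup.
have uJ : uniq (undup J ++ [::]) by rewrite cats0 undup_uniq.
have [_ [-> _]] := field_event_indep iidF s0 uJ dJ.
by have [_ [-> _]] := field_event_indep iidF' s0 uJ dJ.
Qed.

Lemma omega_from_measurable n z : measurable [set a | omega_from (F a) n z].
Proof.
apply: window_measurable => [y|y U]; last first.
  exact: (field_eq_measurable (iid_field_shift iidF (0, - n%:Z))).
by rewrite (_ : [set _ | _] = setT)//; apply/seteqP; split.
Qed.

Lemma omega_limit_measurable z : measurable [set a | omega_limit (F a) z].
Proof.
rewrite (_ : [set _ | _] = \bigcap_n [set a | omega_from (F a) n z]).
  by apply: bigcapT_measurable => n; exact: omega_from_measurable.
apply/seteqP; split => a /= => [/asboolP h n _|h]; first exact: h.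
by apply/asboolP => n; exact: h.
Qed.

(** Only the initial state is random; the field of the next t steps is frozen to s, in the form
    required by [field_fubini]. *)
Definition frozen_prob (w : T -> config d r) A t s : R :=
  fine (P [set a | occupied (window (w a) s t) A]).

Lemma occupied_window_measurable (w : T -> config d r) A t s :
  (forall z, measurable [set a | w a z]) ->
  measurable [set a | occupied (window (w a) s t) A].
Proof.
move=> mw; apply: occupied_measurable.
apply: (window_measurable (F := fun=> s)) => // z U.
exact: const_field_measurable.
Qed.

Let sites A t := undup (window_cones A t).

(** By translation invariance, starting n + t before time 0 amounts to starting n before and running
    t further steps, whose field is independent of the state at time 0. *)
Lemma occupied_from_step A n t :
  P [set a | occupied (omega_from (F a) (n + t)) A] =
  (Ex ups (sites A t) (frozen_prob (fun a => omega_from (F a) n) A t) s0)%:E.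
Proof.
have mw := @omega_from_measurable n.
have [|||_ <-] := @field_fubini R _ T P d r ups F iidF (sites A t)
  (fun s => [set a | occupied (window (omega_from (F a) n) s t) A]) s0 (undup_uniq _).
- move=> s s' ss; apply/funext => a /=; congr is_true.
  by apply: occupied_window_dep => z zA; apply: ss; rewrite mem_undup.
- by move=> s; exact: occupied_window_measurable.
- move=> s; pose J := undup [seq z + (0, - n%:Z) | z <- [seq z <- flatten
      [seq cone r (n + t) (z.1, n%:Z + (t%:Z + val z.2)) | z <- A] | z.2 < n%:Z]].
  have uJ : uniq (J ++ sites A t).
    rewrite cat_uniq !undup_uniq andbT /=; apply/hasPn => z.
    rewrite !mem_undup => /flatten_mapP[y _ /cone_time/andP[z0 _]].
    apply/negP => /mapP[z']; rewrite mem_filter => /andP[z'n _] zE.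
    by move: z0; rewrite zE leNgt /= subr_lt0 z'n.
  have dJ : depends_on J (fun F => occupied (window (omega_from F n) s t) A).
    by move=> u u' uu; apply: occupied_from_dep => z zJ; apply: uu; rewrite mem_undup.
  by have [_ [_ e]] := field_event_indep iidF s uJ dJ.
pose J := flatten [seq cone r (n + t) (z.1, (n + t)%:Z + val z.2) | z <- A].
pose psi (G : site d * int -> upfam d r) := occupied (window (config1 d r) G (n + t)) A.
have dpsi : depends_on J psi by exact: occupied_window_dep.
have i1 := iid_field_shift iidF (0, - (n + t)%:Z).
have i2 := iid_field_shift iidF (0, - n%:Z).
have e1 : P [set a | psi (field_shift (0, - (n + t)%:Z) (F a))] =
    P [set a | psi (F a)] by apply/esym; exact: field_law i1 dpsi.
have e2 : P [set a | psi (field_shift (0, - n%:Z) (F a))] =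
    P [set a | psi (F a)] by apply/esym; exact: field_law i2 dpsi.
rewrite [LHS]e1 -e2; congr (P _); apply/funext => a /=; congr is_true.
apply: eq_all => -[x v]; rewrite /window /= PoszD -addrA.
rewrite [LHS]pca_eta_window ?past_or_nonneg//; congr pca_eta.
apply/funext => z; rewrite /field_shift; congr (F a _).
by rewrite -addrA; case: z => y u; congr (_, _); rewrite /= ?addr0// subrr addr0.
Qed.

(** The events decrease to the limit event by [pca_eta_limit]; then continuity from above. *)
Lemma frozen_prob_cvg A t s :
  frozen_prob (fun a => omega_from (F a) n) A t s @[n --> \oo] -->
  frozen_prob (fun a => omega_limit (F a)) A t s.
Proof.
pose S n := [set a | occupied (window (omega_from (F a) n) s t) A].
pose S' := [set a | occupied (window (omega_limit (F a)) s t) A].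
have mS n : measurable (S n).
  by apply: occupied_window_measurable; exact: omega_from_measurable.
have mS' : measurable S'.
  by apply: occupied_window_measurable; exact: omega_limit_measurable.
have SS' : \bigcap_n S n = S'.
  apply/seteqP; split => a /=.
    move=> h; apply/allP => z zA; apply: pca_eta_limit.
      by move=> n y; exact: omega_fromS.
    by move=> n; have /allP/(_ z zA) := h n I.
  move=> /allP h n _; apply/allP => z /h; apply: pca_eta_mono.
    by move=> y /asboolP.
  by move=> y; exact: leU_refl.
have Santi n k : (n <= k)%N -> S k `<=` S n.
  move=> /subnKC <-; elim: (k - n)%N => [|j IH]; first by rewrite addn0.
  apply: subset_trans IH; rewrite addnS => a /allP h; apply/allP => z /h.
  apply: pca_eta_mono => y; [exact: omega_fromS|exact: leU_refl].
have := @nonincreasing_cvg_mu _ T R P S.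
rewrite SS' => /(_ _ mS mS' _) H.
apply: fine_cvg; rewrite fineK ?fin_num_measure//; apply: H.
  by rewrite (le_lt_trans (probability_le1 _ _))// ltry.
by move=> n k nk; apply/subsetPset; exact: Santi.
Qed.

(** Let n tend to infinity in [occupied_from_step]: the left side by the case t = 0 of
    [frozen_prob_cvg], the right side by [cvg_Ex]. *)
Lemma occupied_limit_stationary A t :
  fine (P [set a | occupied (omega_limit (F a)) A]) =
  Ex ups (sites A t) (frozen_prob (fun a => omega_limit (F a)) A t) s0.
Proof.
have c1 := @cvg_Ex R _ _ ups (sites A t) _ _ s0 (fun s => @frozen_prob_cvg A t s).
have c2 : fine (P [set a | occupied (omega_from (F a) n) A]) @[n --> \oo] -->
    fine (P [set a | occupied (omega_limit (F a)) A]).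
  have := @frozen_prob_cvg A 0 s0; rewrite /frozen_prob.
  have E (w : T -> config d r) : [set a | occupied (window (w a) s0 0) A] =
      [set a | occupied (w a) A] by apply/funext => a /=; rewrite window0.
  by rewrite E; under eq_fun do rewrite E.
have c3 : fine (P [set a | occupied (omega_from (F a) (n + t)) A]) @[n --> \oo] -->
    fine (P [set a | occupied (omega_limit (F a)) A]) by exact: cvg_comp (cvg_addnr t) c2.
rewrite -(cvg_lim (@Rhausdorff R) c3) -(cvg_lim (@Rhausdorff R) c1).
by congr (lim (_ @ \oo)); apply/funext => n; rewrite occupied_from_step.
Qed.

End LimitMeasure.

Section InvariantMeasure.
Context (R : realType) (d : nat) (r : R) (ups : pca d r).

(** By Fubini, t steps from any independent initial state of law mu give an average of frozen
    probabilities that involves the state only through mu; [occupied_limit_stationary] evaluates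
    it. *)
Lemma limit_measure (dT : measure_display) (T : measurableType dT)
    (P : probability T R) (F : T -> site d * int -> upfam d r) :
  iid_field ups P F -> exists mu : probability (Omega d r) R,
    invariant_measure ups mu /\
    forall E, measurable E -> mu E = P ((fun a => omega_limit (F a)) @^-1` E).
Proof.
move=> iidF.
have law (dT' : measure_display) (T' : measurableType dT') (P' : probability T' R)
    (w : T' -> Omega d r) : (forall z, measurable [set a | w a z]) ->
    exists nu : probability (Omega d r) R, forall E, nu E = P' (w @^-1` E).
  move=> mw; have mf := measurable_to_Omega mw.
  pose X : {mfun T' >-> Omega d r} := mfun_Sub (mem_set mf).
  by exists (distribution P' X).
have [mu muE] := law _ T P (fun a => omega_limit (F a)) (omega_limit_measurable iidF).
exists mu; split => // dT' T' P' w' F' mw' w'E iidF' ind t E mE.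
have mz z : measurable [set a | w' a z].
  by have := mw' measurableT _ (Omega_coordinate_measurable z); rewrite setTI.
have mW z : measurable [set a | window (w' a) (F' a) t z].
  by apply: window_measurable => // y U; exact: (field_eq_measurable iidF').
have [nu nuE] := law _ T' P' (fun a => window (w' a) (F' a) t) mW.
rewrite -[LHS]nuE; apply: (@Omega_measure_unique _ _ _ nu mu _ E mE) => A.
rewrite nuE muE /=.
have mPhi s : measurable [set a | occupied (window (w' a) s t) A].
  exact: occupied_window_measurable.
pose L := undup (window_cones A t).
have mO s : measurable [set w : Omega d r | occupied (window w s t) A].
  apply: (@occupied_window_measurable _ _ _ _ (Omega d r) (fun w => w)).
  exact: Omega_coordinate_measurable.
have [|||_ e] := @field_fubini R _ T' P' d r ups F' iidF' L
  (fun s => [set a | occupied (window (w' a) s t) A]) closed (undup_uniq _).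
- move=> s s' ss; apply/funext => a /=; congr is_true.
  by apply: occupied_window_dep => z zA; apply: ss; rewrite mem_undup.
- exact: mPhi.
- move=> s; rewrite (ind [set w | occupied (window w s t) A])//.
    rewrite (agree_prob iidF') ?undup_uniq// EFinM fineK//.
    by rewrite fin_num_measure//; exact: mPhi.
  rewrite agreeE.
  apply: (@fin_bigcap_measurable _ (g_sigma_algebraType (field_events F'))).
    exact: finite_fset.
  by move=> z _; apply: sub_sigma_algebra; exists z, [set s z]%SET.
rewrite [LHS]e -[RHS]fineK ?fin_num_measure//; last first.
  by apply: occupied_measurable; exact: (omega_limit_measurable iidF).
congr (_%:E); rewrite [RHS](occupied_limit_stationary iidF A t).
apply: eq_Ex => s; rewrite /frozen_prob; congr fine.
have -> := w'E _ (mO s).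
by rewrite muE.
Qed.

End InvariantMeasure.

(** * Consequences of the uniqueness of the invariant measure *)

Section Subcritical.
Context (R : realType) (d : nat) (r : R) (ups : pca d r).
Hypothesis r1 : 1 <= r.

Lemma past_N1 : (-1 : int) \in past r.
Proof. by rewrite mem_past ltrz0 /= andbT mulrNz lerN2. Qed.

Let u : past r := [` past_N1]%fset.

Lemma eta_from0E (s : site d * int -> upfam d r) z :
  eta_from 0 s z = pca_eta (config1 d r) (fun y => clean (s y)) z.1 z.2.
Proof.
apply: (@eq_pca_eta _ _ _ _ _ _ z.2) => // y y0 _.
by rewrite /cut ltNge y0.
Qed.

Lemma theta_prob (dT : measure_display) (T : measurableType dT)
    (P : probability T R) (F : T -> site d * int -> upfam d r) x j :
  iid_field ups P F -> (forall U : upfam d r, finset.set0 \in val U -> ups U = 0) ->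
  P [set a | pca_eta (config1 d r) (F a) x j%:Z] = (theta ups j)%:E.
Proof.
move=> iidF ups0.
pose psi (G : site d * int -> upfam d r) := pca_eta (config1 d r) G 0 j%:Z.
have dpsi : depends_on (origin_cone r j) psi.
  move=> s s' ss; apply: (@pca_eta_cone _ _ _ _ j.+1 (0, j%:Z)) => [|z zj].
    by rewrite /= ltz_nat ltnSn.
  by apply: ss; rewrite mem_undup.
have i1 := iid_field_shift iidF (x, 0).
have -> : [set a | pca_eta (config1 d r) (F a) x j%:Z] =
    [set a | psi (field_shift (x, 0) (F a))].
  apply/funext => a /=; congr is_true.
  by rewrite -[x in LHS]add0r pca_eta_shift.
have uJ : uniq ((origin_cone r j : seq (site d * int)) ++ [::]).
  by rewrite cats0 undup_uniq.
have [_ [-> _]] := field_event_indep i1 closed uJ dpsi.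
congr (_%:E); rewrite /theta (@Ex_comp_fix _ _ _ _ (@clean R d r)).
- by apply: eq_Ex => s; rewrite eta_from0E.
- move=> U; apply: contraNeq => Uc; apply/eqP/ups0.
  by apply: contraNT Uc => /clean_id->.
- by move=> z; exact: clean_bot.
Qed.

Lemma subcritical_theta : delta0_unique_invariant ups ->
  (forall U : upfam d r, finset.set0 \in val U -> ups U = 0) /\
  theta ups n @[n --> \oo] --> (0 : R).
Proof.
move=> [inv0 uniq0].
pose E : set (Omega d r) := [set w | w (0, u)].
have mE : measurable E by exact: Omega_coordinate_measurable.
have dE : delta0 d r E = 0%E.
  by rewrite [LHS](_ : _ = (\1_E (config0 d r))%:E)// indicE memNset.
have [[dT [T [P [F iidF]]]]|noF] := pselect (exists dT (T : measurableType dT)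
    (P : probability T R) (F : T -> site d * int -> upfam d r), iid_field ups P F);
  last first.
  (* Without a field, the point mass at all ones would be vacuously invariant. *)
  pose mu : probability (Omega d r) R := \d_(config1 d r : Omega d r).
  have /uniq0/(_ E mE) : invariant_measure ups mu.
    by move=> dT T P w F _ _ iidF; exfalso; apply: noF; exists dT, T, P, F.
  rewrite dE [mu E](_ : _ = (\1_E (config1 d r))%:E)// indicE mem_set// => -[].
  by move/eqP; rewrite oner_eq0.
have ups0 (U : upfam d r) : finset.set0 \in val U -> ups U = 0.
  have mw : measurable_fun setT (fun _ : T => config0 d r : Omega d r).
    exact: measurable_cst.
  have preE (G : set (Omega d r)) : (fun _ : T => config0 d r : Omega d r) @^-1` G =
      if `[< G (config0 d r) >] then setT else set0.
    by case: asboolP => h; apply/seteqP; split.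
  have h1 G : measurable G -> P ((fun _ : T => config0 d r : Omega d r) @^-1` G) =
      delta0 d r G.
    move=> _; rewrite preE [RHS](_ : _ = (\1_G (config0 d r))%:E)// indicE.
    case: asboolP => h; first by rewrite mem_set// probability_setT.
    by rewrite memNset// measure0.
  have h2 : indep_of_field P (fun _ : T => config0 d r : Omega d r) F.
    move=> G B _ _; rewrite preE; case: ifP => _.
      by rewrite setTI probability_setT mul1e.
    by rewrite set0I measure0 mul0e.
  (* One step from all zeros opens the origin exactly when its family contains the empty set. *)
  have := inv0 dT T P _ F mw h1 iidF h2 1%N E mE; rewrite dE.
  pose B := [set V : upfam d r | finset.set0 \in val V]%SET.
  have -> : [set a | E (window (config0 d r) (F a) 1)] =
      [set a | F a (0, 0%:Z) \in B].
    apply/funext => a /=; congr is_true.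
    rewrite /window /= (pca_eta_nextE _ _ _ 0) finset.in_set; apply: eq_in_val => //.
    apply/finset.setP => y; rewrite !finset.inE.
    by rewrite pca_eta_neg ?(nbh_time y 0)//; case: insubP.
  case: iidF => _ -> _ [] /psumr_eq0P h U0; apply: h => [V _|]; first exact: mass_ge0.
  by rewrite finset.in_set.
split => //.
have [mu [muinv muE]] := limit_measure iidF.
have P0 : P [set a | omega_limit (F a) (0, u)] = 0%E.
  by rewrite -[LHS](muE E mE) (uniq0 _ muinv _ mE).
have frozenE (w : T -> config d r) : frozen_prob P w [:: (0, u)] 0 closed =
    fine (P [set a | w a (0, u)]).
  rewrite /frozen_prob; congr (fine (P _)); apply/funext => a /=.
  by rewrite window0 andbT.
have c := @frozen_prob_cvg _ _ _ _ _ _ _ _ iidF [:: (0, u)] 0 closed.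
rewrite frozenE P0 in c.
(* The coordinate u is time -1, so starting j + 1 before time 0 reads the process at time j. *)
have -> : theta ups = (fun n => frozen_prob P (fun a => omega_from (F a) n)
    [:: (0, u)] 0 closed) \o addn^~ 1%N; last exact: cvg_comp (cvg_addnr 1) c.
apply/funext => j /=; rewrite frozenE addn1 /omega_from /window /=.
have -> : j.+1%:Z + -1 = j by rewrite -addn1 PoszD addrK.
by rewrite (theta_prob _ _ (iid_field_shift iidF _)).
Qed.

End Subcritical.

(** * Light cone and conclusion *)

Section LightCone.
Context (R : realType) (d : nat) (r : R).
Implicit Types (A : {fset site d * past r}) (G : site d * int -> upfam d r).

Lemma nbh_bound (N : nat) (y : nbh d r) i : r <= N%:R -> `|(val y).1 0 i| <= N%:Z.
Proof.
move=> rN; have := fsvalP y; rewrite mem_nbh => /andP[/forallP/(_ i)/andP[h1 h2] _].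
by rewrite ler_norml -!(ler_int R) mulrNz (le_trans h2 rN) andbT (le_trans _ h1)// lerN2.
Qed.

(** Bound on the number of updates since the initial window; time 0 already counts one. *)
Definition age (s : int) : nat := if s is Posz t then t.+1 else 0.

(** As no family contains the empty set, an occupied site has an occupied neighbour; tracing back
    ends in A. *)
Lemma light_cone A G (N : nat) : r <= N%:R ->
  (forall z, finset.set0 \notin val (G z)) ->
  forall s x, pca_eta (config_of_set A) G x s ->
    exists2 z, z \in A & forall i, `|x 0 i - z.1 0 i| <= (N * age s)%N%:Z.
Proof.
move=> rN G0; elim/time_ind => [s s0 x|t IH x].
  rewrite pca_eta_neg//; case: insubP => // u _ _ xA; exists (x, u) => // i.
  by rewrite subrr normr0.
rewrite pca_eta_nextE => h.
have /finset.set0Pn[y] : nbh_on (config_of_set A) G (x, t%:Z) != finset.set0.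
  by apply: contraTneq h => ->; exact: G0.
rewrite finset.inE => /(IH _ (nbh_time y t))[z zA xz]; exists z => // i.
have := xz i; have := @nbh_bound N y i rN; rewrite mxE.
have yt : (N * age (t%:Z + (val y).2) <= N * t)%N.
  rewrite leq_mul2l; apply/orP; right; have := nbh_time y t.
  by case: (_ + _).
move: ((val y).1 0 i) (x 0 i) (z.1 0 i) => a b c h1 h2 /=.
have {}h2 := le_trans h2 (yt : (N * age (t%:Z + (val y).2))%N%:Z <= (N * t)%N%:Z).
rewrite mulnS PoszD; have -> : b - c = (- a) + (b + a - c) by lia.
by rewrite (le_trans (ler_normD _ _))// lerD// normrN.
Qed.

Definition box (M : nat) (y : site d) : seq (site d) :=
  [seq \row_i (y 0 i - M%:Z + (g i : nat)%:Z) | g : {ffun 'I_d -> 'I_(M.*2.+1)}].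

Lemma mem_box M (x y : site d) : (forall i, `|x 0 i - y 0 i| <= M%:Z) -> x \in box M y.
Proof.
move=> xy; have lt i : (absz (x 0 i - y 0 i + M%:Z)%R < M.*2.+1)%N.
  by have := xy i; lia.
apply/mapP; exists [ffun i => Ordinal (lt i)]; first by rewrite mem_enum.
apply/rowP => i; rewrite mxE ffunE /=; have := xy i; lia.
Qed.

Lemma size_box M (y : site d) : size (box M y) = ((M.*2.+1) ^ d)%N.
Proof. by rewrite size_map -cardE card_ffun !card_ord. Qed.

End LightCone.

Section UnionBound.
Context (R : realType) (dT : measure_display) (T : measurableType dT).
Variable P : probability T R.

Lemma union_bound (J : eqType) (js : seq J) (B : J -> set T) :
  (forall j, measurable (B j)) ->
  measurable [set a | exists2 j, j \in js & B j a] /\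
  (P [set a | exists2 j, j \in js & B j a] <= \sum_(j <- js) P (B j))%E.
Proof.
move=> mB; elim: js => [|j js [mH IH]].
  have -> : [set a | exists2 j, j \in [::] & B j a] = set0.
    by apply/seteqP; split => a // -[].
  by rewrite big_nil measure0; split.
have -> : [set a | exists2 j0, j0 \in j :: js & B j0 a] =
    B j `|` [set a | exists2 j, j \in js & B j a].
  apply/seteqP; split => a /=.
    by move=> [k]; rewrite inE => /predU1P[->|kj] Bk; [left|right; exists k].
  move=> [Bj|[k kj Bk]]; first by exists j; rewrite ?mem_head.
  by exists k; rewrite ?inE ?kj ?orbT.
split; first exact: measurableU.
rewrite big_cons; apply: (le_trans (measureU2 _ _ _)) => //.
exact: leeD2l.
Qed.

End UnionBound.

Section Conclusion.
Context (R : realType) (d : nat) (r : R).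

Lemma subcritical_unique (p1 p2 : R) (ups : R -> pca d r) q : p1 < p2 ->
  p1 <= q < p_crit p1 p2 ups -> q < p2 /\ delta0_unique_invariant (ups q).
Proof.
move=> p12 /andP[p1q]; rewrite /p_crit; set S := (X in asbool (X = _)).
case: asboolP => [S0|/eqP/set0P[s Ss]] qc.
  split => //; apply: contrapT => nu.
  have : S q by split => //; rewrite p1q ltW.
  by rewrite S0.
have lbS : has_lbound S by exists p1 => x [/andP[]].
have qs : q < p2.
  apply: (lt_le_trans qc); apply: (le_trans (ge_inf lbS Ss)).
  by case: Ss => /andP[].
split => //; apply: contrapT => nu.
have /(ge_inf lbS) : S q by split => //; rewrite p1q ltW.
by rewrite leNgt qc.
Qed.

Lemma survival_le (ups : pca d r) (dT : measure_display) (T : measurableType dT)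
    (P : probability T R) (F : T -> site d * int -> upfam d r) (N t : nat)
    (A : {fset site d * past r}) : r <= N%:R ->
  iid_field ups P F -> (forall U : upfam d r, finset.set0 \in val U -> ups U = 0) ->
  (P [set w | exists x, pca_eta (config_of_set A) (F w) x t%:Z] <=
    (#|` A|%:R * ((N * t.+1).*2.+1)%:R ^+ d * theta ups t)%:E)%E.
Proof.
move=> rN iidF ups0; set M := (N * t.+1)%N.
pose bad z := [set w | F w z \in [set U : upfam d r | finset.set0 \in val U]%SET].
(* [light_cone] holds off this null event; there survival forces an occupied site in a box around A,
   and all ones dominate A. *)
pose Z := \bigcup_z bad z.
have mbad z : measurable (bad z) by exact: field_measurable iidF _ _.
have mZ : measurable Z by apply: countable_bigcupT_measurable => //; exact: countableP.
have PZ : P Z = 0%E.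
  apply: measure_negligible => //.
  have -> : Z = \bigcup_n (oapp bad set0 (choice.unpickle n)).
    apply/seteqP; split => w.
      by move=> [z _ bz]; exists (choice.pickle z) => //; rewrite choice.pickleK.
    by move=> [n _]; case: (choice.unpickle n) => // z bz; exists z.
  apply: negligible_bigcup => n.
  case: (choice.unpickle n) => [z|]; last exact: negligible_set0.
  exists (bad z); split => //; case: iidF => _ marg _; rewrite [LHS]marg; congr (_%:E).
  by rewrite /meas big1// => U; rewrite finset.in_set => /ups0.
pose js := [seq x | z <- enum_fset A, x <- box M z.1].
pose B x := [set w | pca_eta (config1 d r) (F w) x t%:Z].
have mB x : measurable (B x).
  apply: pca_eta_measurable => [z|z U]; last exact: (field_eq_measurable iidF).
  by rewrite (_ : [set _ | _] = setT)//; apply/seteqP; split.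
have [mH PH] := union_bound P js mB.
apply: (@le_trans _ _ (P (Z `|` [set w | exists2 x, x \in js & B x w]))).
  apply: le_measure; rewrite ?inE.
  - rewrite (_ : [set _ | _] =
      \bigcup_x [set w | pca_eta (config_of_set A) (F w) x t%:Z]); last first.
      by apply/seteqP; split => w [x] => [?|_ ?]; exists x.
    apply: countable_bigcupT_measurable => [|x]; first exact: countableP.
    apply: pca_eta_measurable => [z|z U]; last exact: (field_eq_measurable iidF).
    have [zA|zA] := boolP (config_of_set A z).
      by rewrite (_ : [set _ | _] = setT)//; apply/seteqP; split.
    by rewrite (_ : [set _ | _] = set0)//; apply/seteqP; split.
  - exact: measurableU.
  move=> w [x wx]; have [Zw|nZ] := pselect (Z w); [by left|right].
  have G0 z : finset.set0 \notin val (F w z).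
    by apply/negP => h; apply: nZ; exists z => //; rewrite /bad /= finset.in_set.
  have [z zA xz] := light_cone rN G0 wx.
  exists x; last first.
    apply: pca_eta_mono wx => // y; exact: leU_refl.
  by apply/allpairsPdep; exists z, x; split => //; exact: mem_box.
apply: (le_trans (measureU2 _ _ _)) => //; rewrite [X in (X + _)%E](_ : _ = 0%E)//.
rewrite add0e; apply: (le_trans PH).
under eq_bigr do rewrite (theta_prob _ _ iidF ups0).
rewrite sumEFin lee_fin big_const_seq count_predT iter_addr_0.
rewrite -[leLHS]mulr_natl ler_wpM2r ?theta_ge0 ?mass_sum1//; first exact: mass_ge0.
rewrite -natrX -natrM ler_nat size_allpairs_dep sumnE big_map.
under eq_bigr do rewrite size_box.
by rewrite big_const_seq count_predT iter_addn_0 mulnC.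
Qed.

End Conclusion.

(** Polynomial growth costs half the exponential rate: 1 + e t <= exp (e t) with e = c / (2 (d +
    1)), so that d e <= c / 2. *)
Lemma polynomial_decay (R : realType) (c : R) (K d t : nat) : 0 < c ->
  ((K * t.+1).*2.+1)%:R ^+ d <=
  (K.*2.+1%:R * (1 + (2 * d.+1%:R) / c)) ^+ d * expR (c / 2 * t%:R).
Proof.
move=> c0; have d0 : 0 < d.+1%:R :> R by [].
pose e := c / (2 * d.+1%:R).
have e0 : 0 < e by rewrite divr_gt0// mulr_gt0.
have -> : (2 * d.+1%:R) / c = e^-1 by rewrite /e invf_div.
have ei0 : 0 < e^-1 by rewrite invr_gt0.
have t0 : 0 <= t%:R :> R by [].
have h : (K * t.+1).*2.+1%:R <= K.*2.+1%:R * (1 + e^-1) * expR (e * t%:R).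
  apply: (@le_trans _ _ (K.*2.+1%:R * t.+1%:R)).
    by rewrite -natrM ler_nat; nia.
  rewrite -mulrA ler_wpM2l// -natr1.
  apply: (@le_trans _ _ ((1 + e^-1) * (1 + e * t%:R))); last first.
    by rewrite ler_wpM2l ?expR_ge1Dx// addr_ge0// ltW.
  rewrite mulrDl mul1r mulrDr mulr1 mulrA mulVf ?gt_eqF// mul1r.
  by have := mulr_ge0 (ltW e0) t0; lra.
apply: (@le_trans _ _ ((K.*2.+1%:R * (1 + e^-1) * expR (e * t%:R)) ^+ d)).
  by apply: lerXn2r; rewrite ?nnegrE// (le_trans _ h).
rewrite exprMn ler_wpM2l ?exprn_ge0 ?mulr_ge0 ?addr_ge0 ?(ltW ei0)//.
rewrite -expRM_natl ler_expR.
have -> : d%:R * (e * t%:R) = c / 2 * t%:R * (d%:R / d.+1%:R).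
  by rewrite /e; field; rewrite gt_eqF.
rewrite ler_piMr//; first by rewrite mulr_ge0// divr_ge0// ltW.
by rewrite ler_pdivrMr// mul1r ler_nat.
Qed.

Theorem theorem1p3 (R : realType) (d : nat) (r : R) (p1 p2 : R)
    (ups : R -> pca d r) :
  (1 <= d)%N -> 1 <= r -> p1 < p2 ->
  parametrised_model p1 p2 ups ->
  strongly_increasing p1 p2 ups ->
  forall p : R, p1 <= p < p_crit p1 p2 ups ->
  exists c C : R, [/\ 0 < c, 0 < C &
    forall (dT : measure_display) (T : measurableType dT)
      (P : probability T R) (F : T -> site d * int -> upfam d r),
      iid_field (ups p) P F ->
      forall t : nat, (0 < t)%N ->
        (P [set w | pca_eta (config1 d r) (F w) 0 t%:Z]
          <= (C * expR (- c * t%:R))%:E)%E /\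
        forall A : {fset site d * past r},
          (P [set w | exists x, pca_eta (config_of_set A) (F w) x t%:Z]
            <= (C * #|` A|%:R * expR (- c * t%:R))%:E)%E].
Proof.
move=> _ r1 p12 C1 incr p /andP[p1p ppc].
(* A still subcritical q above p leaves room for the thinning. *)
pose q := (p + p_crit p1 p2 ups) / 2.
have pq : p < q by rewrite /q; lra.
have qpc : q < p_crit p1 p2 ups by rewrite /q; lra.
have [qp2 uq] : q < p2 /\ delta0_unique_invariant (ups q).
  by apply: (subcritical_unique p12); rewrite qpc andbT (le_trans p1p)// ltW.
have [_ up] : p < p2 /\ delta0_unique_invariant (ups p).
  by apply: (subcritical_unique p12); rewrite ppc p1p.
have [ups0 _] := subcritical_theta r1 up.
have [_ cvq] := subcritical_theta r1 uq.
have [x x01 dom] := strongly_increasing_thin C1 incr p1p pq (ltW qp2).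
have [c [C [c0 C0 hC]]] := thinned_decay (mass_ge0 (ups q)) (mass_sum1 (ups q)) cvq x01.
(* Survival at p is at most survival under the thinned law at q. *)
have thp n : theta (ups p) n <= C * expR (- c * n%:R).
  apply: (le_trans _ (hC n)).
  apply: (@Ex_dominated _ _ _ (@leU R d r) (@leU_refl R d r)) => //.
  - exact: mass_ge0.
  - move=> U; apply: thin_ge0; first exact: mass_ge0.
    by case/andP: x01 => *; rewrite !ltW.
  - exact: eta_from_ex_mono.
pose N := Num.bound r.
have rN : r <= N%:R by rewrite ltW// archi_boundP// (le_trans ler01).
pose D : R := (N.*2.+1%:R * (1 + (2 * d.+1%:R) / c)) ^+ d.
have D1 : 1 <= D.
  rewrite exprn_ege1// mulr_ege1 ?ler1n// lerDl divr_ge0 ?mulr_ge0//; exact: ltW.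
have D0 : 0 < D by rewrite (lt_le_trans ltr01).
exists (c / 2), (C * D); split; [by rewrite divr_gt0|by rewrite mulr_gt0|].
move=> dT T P F iidF t t0.
(* One half of the decay absorbs the number of sites within reach of A. *)
have half : expR (- c * t%:R) = expR (- (c / 2) * t%:R) * expR (- (c / 2) * t%:R).
  by rewrite -expRD; congr expR; field.
have le1 : expR (- (c / 2) * t%:R) <= 1.
  by rewrite -[leRHS]expR0 ler_expR mulNr oppr_le0 mulr_ge0// divr_ge0// ltW.
have inv : expR (c / 2 * t%:R) * expR (- (c / 2) * t%:R) = 1.
  by rewrite mulNr expRxMexpNx_1.
split.
  rewrite (theta_prob _ _ iidF ups0) lee_fin; apply: (le_trans (thp t)).
  rewrite half -mulrA ler_pM2l//; apply: ler_pM; rewrite ?expR_ge0//.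
  exact: le_trans D1.
move=> A; apply: (le_trans (survival_le t A rN iidF ups0)); rewrite lee_fin.
set y := expR (- (c / 2) * t%:R) in half inv *.
have -> : C * D * #|` A|%:R * y =
    #|` A|%:R * (D * expR (c / 2 * t%:R)) * (C * (y * y)).
  transitivity (C * D * #|` A|%:R * y * (expR (c / 2 * t%:R) * y)); last by ring.
  by rewrite inv mulr1.
rewrite -half; apply: ler_pM.
- by rewrite mulr_ge0// exprn_ge0.
- by apply: theta_ge0; [exact: mass_ge0|exact: mass_sum1].
- by rewrite ler_wpM2l// polynomial_decay.
- exact: thp.
Qed.
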